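(* Let $X$ be a simply connected proper geodesic metric space and let $\bar X$ be its Higson compactification. Then there are an index set $\mathcal A$ and a topological embedding $$F:\bar X\to\prod_{\mathcal A}\Sigma_\infty$$ of $\bar X$ into a product of copies of the adelic solenoid $\Sigma_\infty$ such that $F$ induces an isomorphism of 1-dimensional Čech cohomology (with integer coefficients), $F^*:\check H^1\big(\prod_{\mathcal A}\Sigma_\infty\big)\to\check H^1(\bar X)$.
   Context: A metric space $X$ is proper if for each point the distance-to-that-point function is a proper map (equivalently, closed bounded sets are compact). It is geodesic if for all $x,y\in X$ there is an isometric embedding $\xi:[0,d(x,y)]\to X$ with $\xi(0)=x$, $\xi(d(x,y))=y$. Let $(X,d)$ be a metric space with base point $x_0$, and let $B(x,r)$ be the open ball of radius $r$ centered at $x$. A map $f:X\to Y$ to a metric space is slowly oscillating if for every $r>0$ the diameter of $f(B(x,r))$ tends to $0$ as $d(x,x_0)\to\infty$. Let $C_h$ be the ring of all bounded continuous slowly oscillating functions $f:X\to\mathbb R$. The Higson compactification $\bar X$ of $X$ is the closure of the image of $X$ under the embedding $(f)_{f\in C_h}:X\to\prod_{f\in C_h}[\inf f,\sup f]$. The adelic solenoid $\Sigma_\infty=\Sigma_{\mathbb Q}$ is the compact abelian topological group given by the inverse limit of the sequence of unit circles $S^1\xleftarrow{z^2}S^1\xleftarrow{z^3}S^1\xleftarrow{z^4}\cdots$, where the bonding homomorphisms are $z\mapsto z^n$, $n=2,3,4,\dots$; equivalently $\Sigma_\infty=(\mathbb R\times\hat{\mathbb Z})/\mathbb Z$ with $\mathbb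 Z$ embedded diagonally and $\hat{\mathbb Z}$ the profinite completion of $\mathbb Z$.
   Formalization: X is additionally assumed non-compact: for compact X (e.g. [0,1]) the Higson compactification is X itself with zero first Čech cohomology, forcing an empty index set, so the claim fails for every compact X except a single point, which is also excluded. *)

(* Defs.v *)
From HB Require Import structures.
From mathcomp Require Import all_boot all_order all_algebra.
From mathcomp Require Import all_classical all_reals all_analysis.
From mathcomp Require Import complex generic_quotient zify.
Import Order.TTheory GRing.Theory Num.Theory.
Import numFieldNormedType.Exports.

Set Implicit Arguments.
Unset Strict Implicit.
Unset Printing Implicit Defensive.

Local Open Scope classical_set_scope.
Local Open Scope ring_scope.
Local Open Scope quotient_scope.

(** Metric spaces *)

Definition proper_map (S T : topologicalType) (f : S -> T) : Prop :=
  continuous f /\ forall K : set T, compact K -> compact (f @^-1` K).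

Definition proper_metric (R : realType) (X : metricType R) : Prop :=
  forall x : X, proper_map (fun y => mdist y x : R^o).

(* Only the restriction of [xi] to [0, mdist x y] matters. *)
Definition geodesic_metric (R : realType) (X : metricType R) : Prop :=
  forall x y : X, exists xi : R -> X,
    [/\ {in `[0, mdist x y] &, forall s t, mdist (xi s) (xi t) = `|s - t|},
        xi 0 = x & xi (mdist x y) = y].

(* Paths and homotopies are functions on R and R * R, of which only the
   restrictions to the unit interval and to the unit square matter. *)
Definition path_between (R : realType) (X : topologicalType)
    (gamma : R -> X) (x y : X) : Prop :=
  [/\ {within `[0, 1], continuous gamma}, gamma 0 = x & gamma 1 = y].

Definition path_connected (R : realType) (X : topologicalType) : Prop :=
  forall x y : X, exists gamma : R -> X, path_between gamma x y.

Definition nullhomotopic_loop (R : realType) (X : topologicalType)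
    (x : X) (gamma : R -> X) : Prop :=
  exists H : R * R -> X,
    [/\ {within `[0, 1] `*` `[0, 1], continuous H},
        {in `[0, 1], forall s, H (s, 0) = gamma s},
        {in `[0, 1], forall s, H (s, 1) = x} &
        {in `[0, 1], forall t, H (0, t) = x /\ H (1, t) = x}].

Definition simply_connected (R : realType) (X : topologicalType) : Prop :=
  path_connected R X /\
  forall (x : X) (gamma : R -> X),
    path_between gamma x x -> nullhomotopic_loop x gamma.

Definition diam (R : realType) (Y : metricType R) (A : set Y) : \bar R :=
  ereal_sup [set d | exists a b, [/\ A a, A b & d = (mdist a b)%:E]].

(* The diameter of f (B(x, r)) tends to 0 as d(x, x0) tends to infinity. *)
Definition slowly_oscillating (R : realType) (X Y : metricType R) (x0 : X)
    (f : X -> Y) : Prop :=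
  forall r : R, 0 < r -> forall e : R, 0 < e ->
  exists M : R, forall x : X, M < mdist x x0 ->
    (diam (f @` ball x r) < e%:E)%E.

(** Higson compactification *)

Definition higson_functions (R : realType) (X : metricType R) (x0 : X)
    : set (X -> R^o) :=
  [set f : X -> R^o |
    [/\ bounded_fun f, continuous f & slowly_oscillating (Y := R^o) x0 f]].

Section higson_compactification.
Context {R : realType} {X : metricType R} (x0 : X).

Definition higson_interval (f : higson_functions x0) : set R^o :=
  `[inf (range (set_val f)), sup (range (set_val f))].

Definition higson_cube :=
  prod_topology (fun f : higson_functions x0 => higson_interval f).

Lemma higson_interval_mem (f : higson_functions x0) (x : X) :
  set_val f x \in higson_interval f.
Proof.
have [bf _ _] := set_valP f; rewrite inE /higson_interval /= in_itv /=; apply/andP; split.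
- apply: ge_inf; last by exists x.
  exact: bounded_fun_has_lbound.
- apply: ub_le_sup; last by exists x.
  exact: bounded_fun_has_ubound.
Qed.

Definition higson_embed (x : X) : higson_cube :=
  fun f => exist _ (set_val f x) (higson_interval_mem f x).

Definition higson_compactification : topologicalType :=
  closure (range higson_embed).

End higson_compactification.

(** The adelic solenoid *)

Definition circle (R : realType) : set R[i]^o := [set z | `|z| = 1].

(* The inverse limit of S^1 <- S^1 <- S^1 <- ... along z^2, z^3, z^4, ... *)
Definition adelic_solenoid (R : realType) : topologicalType :=
  [set s : prod_topology (fun _ : nat => @circle R) |
    forall n, set_val (s n.+1) ^+ n.+2 = set_val (s n)].

Definition topological_embedding (S T : topologicalType) (f : S -> T) : Prop :=
  [/\ continuous f, injective f &
      forall U : set S, open U ->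
        exists2 V : set T, open V & f @` U = range f `&` V].

(** First Cech cohomology group with integer coefficients: the direct limit,
    over the open covers ordered by refinement, of the simplicial cohomology of
    their nerves.  The simplices of the nerve of a cover U are the tuples of
    members of U with nonempty intersection. *)

Record open_cover (X : topologicalType) := OpenCover {
  members :> set (set X);
  members_open : forall A, members A -> open A;
  members_cover : \bigcup_(A in members) A = setT }.

Section nerve.
Context {X : topologicalType}.
Implicit Types (U : set (set X)) (c : set X -> set X -> int).

(* Ordered cochains, extended by arbitrary values to tuples that are not
   simplices of the nerve. *)
Definition cocycle1 U c : Prop :=
  forall A B C, U A -> U B -> U C -> A `&` B `&` C !=set0 ->
    c B C - c A C + c A B = 0.

Definition coboundary1 U c : Prop :=
  exists b : set X -> int,
    forall A B, U A -> U B -> A `&` B !=set0 -> c A B = b B - b A.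

End nerve.

(* [p] is a projection from the cover [V] of [S] to the preimage under [f] of
   the cover [U] of [T]; for [f = id], a refinement projection. *)
Definition projection (S T : Type) (f : S -> T) (V : set (set S))
    (U : set (set T)) (p : set S -> set T) : Prop :=
  forall A, V A -> U (p A) /\ A `<=` f @^-1` (p A).

Definition pull (S T : Type) (p : set S -> set T)
  (c : set T -> set T -> int) : set S -> set S -> int :=
  fun A B => c (p A) (p B).

Record cech_cocycle (X : topologicalType) := CechCocycle {
  cov : open_cover X;
  cochain : set X -> set X -> int;
  cochain_cocycle : cocycle1 cov cochain }.

HB.instance Definition _ (X : topologicalType) := gen_eqMixin (cech_cocycle X).
HB.instance Definition _ (X : topologicalType) :=
  gen_choiceMixin (cech_cocycle X).

(* Equality in the direct limit. *)
Definition cech_equiv (X : topologicalType) (a b : cech_cocycle X) : Prop :=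
  exists (W : open_cover X) (p q : set X -> set X),
    [/\ projection id W (cov a) p, projection id W (cov b) q &
        coboundary1 W (fun A B => pull p (cochain a) A B
                                  - pull q (cochain b) A B)].

Section cech_theory.

Lemma cocycle1D (X : topologicalType) (U : set (set X)) c d :
  cocycle1 U c -> cocycle1 U d -> cocycle1 U (fun A B => c A B + d A B).
Proof.
move=> cc cd A B C UA UB UC h.
have := cc _ _ _ UA UB UC h; have := cd _ _ _ UA UB UC h.
by lia.
Qed.

Lemma cocycle1N (X : topologicalType) (U : set (set X)) c :
  cocycle1 U c -> cocycle1 U (fun A B => - c A B).
Proof.
by move=> cc A B C UA UB UC h; have := cc _ _ _ UA UB UC h; lia.
Qed.

Lemma cocycle1_pull (S T : topologicalType) (f : S -> T) V U p c :
  projection f V U p -> cocycle1 U c -> cocycle1 V (pull p c).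
Proof.
move=> pP cc A B C VA VB VC [x [[Ax Bx] Cx]].
have [[UA sA] [UB sB] [UC sC]] := And3 (pP _ VA) (pP _ VB) (pP _ VC).
apply: cc => //; exists (f x); split; first by split; [exact: sA|exact: sB].
exact: sC.
Qed.

Lemma coboundary1_pull (S T : topologicalType) (f : S -> T) V U p c :
  projection f V U p -> coboundary1 U c -> coboundary1 V (pull p c).
Proof.
move=> pP [b bP]; exists (b \o p) => A B VA VB [x [Ax Bx]].
have [[UA sA] [UB sB]] := conj (pP _ VA) (pP _ VB).
by apply: bP => //; exists (f x); split; [exact: sA|exact: sB].
Qed.

Lemma coboundary1D (X : topologicalType) (U : set (set X)) c d :
  coboundary1 U c -> coboundary1 U d ->
  coboundary1 U (fun A B => c A B + d A B).
Proof.
move=> [b bP] [b' b'P]; exists (fun A => b A + b' A) => A B UA UB h.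
by rewrite bP// b'P//; lia.
Qed.

Lemma coboundary1N (X : topologicalType) (U : set (set X)) c :
  coboundary1 U c -> coboundary1 U (fun A B => - c A B).
Proof.
move=> [b bP]; exists (fun A => - b A) => A B UA UB h.
by rewrite bP//; lia.
Qed.

Lemma eq_coboundary1 (X : topologicalType) (U : set (set X)) c d :
  (forall A B, d A B = c A B) -> coboundary1 U c -> coboundary1 U d.
Proof. by move=> dc [b bP]; exists b => A B *; rewrite dc bP. Qed.

Lemma projection_comp (S T Y : Type) (g : S -> T) (f : T -> Y) W V U q p :
  projection g W V q -> projection f V U p ->
  projection (f \o g) W U (p \o q).
Proof.
move=> qP pP A WA; have [VqA sA] := qP _ WA; have [UA sqA] := pP _ VqA.
by split => // x Ax; apply: sqA; exact: sA.
Qed.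

Lemma contiguous (S T : topologicalType) (f : S -> T) V U p q c :
  projection f V U p -> projection f V U q -> cocycle1 U c ->
  coboundary1 V (fun A B => pull p c A B - pull q c A B).
Proof.
move=> pP qP cc; exists (fun A => c (q A) (p A)) => A B VA VB [x [Ax Bx]].
have [[Up sp] [Uq sq]] := conj (pP _ VA) (qP _ VA).
have [[Up' sp'] [Uq' sq']] := conj (pP _ VB) (qP _ VB).
have [pAx pBx] := conj (sp _ Ax) (sp' _ Bx).
have [qAx qBx] := conj (sq _ Ax) (sq' _ Bx).
have ne (P Q Z : set T) : P (f x) -> Q (f x) -> Z (f x) -> P `&` Q `&` Z !=set0.
  by move=> *; exists (f x).
have := cc _ _ _ Uq Up Up' (ne _ _ _ qAx pAx pBx).
have := cc _ _ _ Uq Uq' Up' (ne _ _ _ qAx qBx pBx).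
by rewrite /pull; lia.
Qed.

Section meet.
Context {X : topologicalType} (U V : open_cover X).

Definition meet_members : set (set X) :=
  [set A | exists B C, [/\ members U B, members V C & A = B `&` C]].

Lemma meet_open A : meet_members A -> open A.
Proof.
by move=> [B [C [UB VC ->]]]; apply: openI; exact: members_open UB || exact: members_open VC.
Qed.

Lemma meet_cover : \bigcup_(A in meet_members) A = setT.
Proof.
rewrite -subTset => x _.
have [B UB Bx] : (\bigcup_(A in members U) A) x by rewrite members_cover.
have [C VC Cx] : (\bigcup_(A in members V) A) x by rewrite members_cover.
by exists (B `&` C) => //; exists B, C.
Qed.

Definition meet := OpenCover meet_open meet_cover.

Definition meetl (A : set X) : set X :=
  xget set0 [set B | members U B /\ exists2 C, members V C & A = B `&` C].
Definition meetr (A : set X) : set X :=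
  xget set0 [set C | members V C /\ exists2 B, members U B & A = B `&` C].

Lemma meetlP : projection id meet U meetl.
Proof.
move=> A [B [C [UB VC AE]]]; rewrite /meetl.
by case: xgetP => [D _ [UD [C' _ ->]]|/(_ B)[]]; [split => // x []|split => //; exists C].
Qed.

Lemma meetrP : projection id meet V meetr.
Proof.
move=> A [B [C [UB VC AE]]]; rewrite /meetr.
by case: xgetP => [D _ [UD [C' _ ->]]|/(_ C)[]]; [split => // x []|split => //; exists B].
Qed.

End meet.

Context {X : topologicalType}.
Implicit Types a b d : cech_cocycle X.

Lemma cech_equiv_refl a : cech_equiv a a.
Proof.
exists (cov a), id, id; split; [by move=> A ?; split..|].
by exists (fun=> 0) => A B *; rewrite !subrr.
Qed.

Lemma cech_equiv_sym a b : cech_equiv a b -> cech_equiv b a.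
Proof.
move=> [W [p [q [pP qP h]]]]; exists W, q, p; split => //.
by apply: eq_coboundary1 (coboundary1N h) => A B; rewrite opprB.
Qed.

Lemma cech_equiv_trans a b d :
  cech_equiv a b -> cech_equiv b d -> cech_equiv a d.
Proof.
move=> [W [p [q [pP qP h]]]] [W' [p' [q' [pP' qP' h']]]].
have [lP rP] := conj (@meetlP _ W W') (@meetrP _ W W').
exists (meet W W'), (p \o meetl W W'), (q' \o meetr W W'); split.
- exact: projection_comp lP pP.
- exact: projection_comp rP qP'.
have H1 := coboundary1_pull lP h; have H2 := coboundary1_pull rP h'.
have H3 := contiguous (projection_comp lP qP) (projection_comp rP pP')
                      (cochain_cocycle (c := b)).
apply: eq_coboundary1 (coboundary1D (coboundary1D H1 H2) H3) => A B.
by rewrite /pull /= /pull; lia.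
Qed.

End cech_theory.

Definition cech_rel (X : topologicalType) : rel (cech_cocycle X) :=
  fun a b => `[< cech_equiv a b >].

Lemma cech_rel_equiv (X : topologicalType) : equiv_class_of (@cech_rel X).
Proof.
split.
- by move=> a; apply/asboolP; exact: cech_equiv_refl.
- by move=> a b; apply/asboolP/asboolP; exact: cech_equiv_sym.
- move=> b a d /asboolP ab /asboolP bd.
  by apply/asboolP; exact: cech_equiv_trans bd.
Qed.

Canonical cech_equiv_rel (X : topologicalType) :=
  EquivRelPack (cech_rel_equiv X).

Definition cechH1 (X : topologicalType) := {eq_quot (cech_equiv_rel X)}.

HB.instance Definition _ (X : topologicalType) := Choice.on (cechH1 X).
HB.instance Definition _ (X : topologicalType) :=
  EqQuotient.on (cechH1 X).

Section cech_group.
Context {X : topologicalType}.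
Implicit Types a b d : cech_cocycle X.

Lemma cech_piP a b :
  (\pi_(cechH1 X) a = \pi_(cechH1 X) b) <-> cech_equiv a b.
Proof.
split; first by move/eqmodP/asboolP.
by move=> h; apply/eqmodP/asboolP.
Qed.

Definition trivial_members : set (set X) := [set setT].

Lemma trivial_open A : trivial_members A -> open A.
Proof. by move=> ->; exact: openT. Qed.

Lemma trivial_cover : \bigcup_(A in trivial_members) A = setT.
Proof. by rewrite -subTset => x _; exists setT. Qed.

Lemma cocycle1_0 (U : set (set X)) : cocycle1 U (fun _ _ => 0).
Proof. by move=> A B C *; rewrite subr0 addr0. Qed.

Definition cocycle_zero :=
  @CechCocycle X (OpenCover trivial_open trivial_cover) _
    (cocycle1_0 (U := trivial_members)).

Definition cocycle_opp a :=
  @CechCocycle X (cov a) _ (cocycle1N (cochain_cocycle (c := a))).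

Definition cocycle_add a b :=
  @CechCocycle X (meet (cov a) (cov b)) _
    (cocycle1D (cocycle1_pull (@meetlP _ (cov a) (cov b))
                              (cochain_cocycle (c := a)))
               (cocycle1_pull (@meetrP _ (cov a) (cov b))
                              (cochain_cocycle (c := b)))).

(* The class of a sum can be computed on any common refinement. *)
Lemma cech_equiv_add a b d (W : open_cover X) p q r :
  projection id W (cov a) p -> projection id W (cov b) q ->
  projection id W (cov d) r ->
  coboundary1 W (fun A B => pull p (cochain a) A B + pull q (cochain b) A B
                            - pull r (cochain d) A B) ->
  cech_equiv (cocycle_add a b) d.
Proof.
move=> pP qP rP h.
set V := meet (cov a) (cov b); set Z := meet V W.
have [lP' rP'] := conj (@meetlP _ V W) (@meetrP _ V W).
have [lP mP] := conj (@meetlP _ (cov a) (cov b)) (@meetrP _ (cov a) (cov b)).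
exists Z, (meetl V W), (r \o meetr V W); split => //.
  exact: projection_comp rP' rP.
have H1 := contiguous (projection_comp lP' lP) (projection_comp rP' pP)
                      (cochain_cocycle (c := a)).
have H2 := contiguous (projection_comp lP' mP) (projection_comp rP' qP)
                      (cochain_cocycle (c := b)).
have H3 := coboundary1_pull rP' h.
apply: eq_coboundary1 (coboundary1D (coboundary1D H1 H2) H3) => A B.
by rewrite /pull /= /pull; lia.
Qed.

Lemma cech_equiv_addl a a' b b' : cech_equiv a a' -> cech_equiv b b' ->
  cech_equiv (cocycle_add a b) (cocycle_add a' b').
Proof.
move=> [W [p [q [pP qP h]]]] [W' [p' [q' [pP' qP' h']]]].
have [lP rP] := conj (@meetlP _ W W') (@meetrP _ W W').
set V := meet (cov a') (cov b').
have [lV rV] := conj (@meetlP _ (cov a') (cov b')) (@meetrP _ (cov a') (cov b')).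
set Z := meet (meet W W') V.
have [lZ rZ] := conj (@meetlP _ (meet W W') V) (@meetrP _ (meet W W') V).
apply: (@cech_equiv_add _ _ _ Z _ _ (meetr (meet W W') V)
  (projection_comp lZ (projection_comp lP pP))
  (projection_comp lZ (projection_comp rP pP'))) => //.
have H1 := coboundary1_pull lZ (coboundary1_pull lP h).
have H2 := coboundary1_pull lZ (coboundary1_pull rP h').
have H3 := contiguous (projection_comp lZ (projection_comp lP qP))
                      (projection_comp rZ lV) (cochain_cocycle (c := a')).
have H4 := contiguous (projection_comp lZ (projection_comp rP qP'))
                      (projection_comp rZ rV) (cochain_cocycle (c := b')).
apply: eq_coboundary1
  (coboundary1D (coboundary1D H1 H2) (coboundary1D H3 H4)) => A B.
by rewrite /pull /= /pull; lia.
Qed.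

Lemma cech_equiv_opp a b :
  cech_equiv a b -> cech_equiv (cocycle_opp a) (cocycle_opp b).
Proof.
move=> [W [p [q [pP qP h]]]]; exists W, p, q; split => //.
by apply: eq_coboundary1 (coboundary1N h) => A B; rewrite /pull /= /pull; lia.
Qed.

Definition cechH1_zero : cechH1 X := \pi_(cechH1 X) cocycle_zero.
Definition cechH1_opp (x : cechH1 X) : cechH1 X := \pi_(cechH1 X) (cocycle_opp (repr x)).
Definition cechH1_add (x y : cechH1 X) : cechH1 X :=
  \pi_(cechH1 X) (cocycle_add (repr x) (repr y)).

Lemma repr_pi_equiv a : cech_equiv (repr (\pi_(cechH1 X) a)) a.
Proof. by apply/cech_piP; rewrite reprK. Qed.

Lemma cechH1_addE a b :
  cechH1_add (\pi_(cechH1 X) a) (\pi_(cechH1 X) b) =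
  \pi_(cechH1 X) (cocycle_add a b).
Proof. by apply/cech_piP/cech_equiv_addl; exact: repr_pi_equiv. Qed.

Lemma cechH1_oppE a :
  cechH1_opp (\pi_(cechH1 X) a) = \pi_(cechH1 X) (cocycle_opp a).
Proof. by apply/cech_piP/cech_equiv_opp; exact: repr_pi_equiv. Qed.

Lemma cechH1_addC : commutative cechH1_add.
Proof.
move=> x y; rewrite -(reprK x) -(reprK y) !cechH1_addE; apply/cech_piP.
set a := repr x; set b := repr y.
apply: (@cech_equiv_add a b _ (meet (cov b) (cov a)) _ _ id
  (@meetrP _ _ _) (@meetlP _ _ _)); first by move=> A ?; split.
by exists (fun=> 0) => A B *; rewrite /pull /= /pull; lia.
Qed.

Lemma cechH1_addA : associative cechH1_add.
Proof.
move=> x y z; rewrite -(reprK x) -(reprK y) -(reprK z).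
set a := repr x; set b := repr y; set d := repr z.
rewrite (cechH1_addE b d) (cechH1_addE a b) (cechH1_addE a) (cechH1_addE _ d).
apply/cech_piP.
set V := meet (cov a) (cov b).
have [lV rV] := conj (@meetlP _ (cov a) (cov b)) (@meetrP _ (cov a) (cov b)).
set V' := meet (cov b) (cov d).
have [lV' rV'] := conj (@meetlP _ (cov b) (cov d)) (@meetrP _ (cov b) (cov d)).
set W := meet V (cov d).
have [lW rW] := conj (@meetlP _ V (cov d)) (@meetrP _ V (cov d)).
set Z := meet W V'; have [lZ rZ] := conj (@meetlP _ W V') (@meetrP _ W V').
apply: (@cech_equiv_add a (cocycle_add b d)
  (cocycle_add (cocycle_add a b) d) Z _ _ (meetl W V')
  (projection_comp lZ (projection_comp lW lV)) rZ lZ).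
have H1 := contiguous (projection_comp rZ lV')
  (projection_comp lZ (projection_comp lW rV)) (cochain_cocycle (c := b)).
have H2 := contiguous (projection_comp rZ rV')
  (projection_comp lZ rW) (cochain_cocycle (c := d)).
apply: eq_coboundary1 (coboundary1D H1 H2) => A B.
by rewrite /pull /= /pull /= /pull -/V; lia.
Qed.

Lemma cechH1_add0 : left_id cechH1_zero cechH1_add.
Proof.
move=> x; rewrite -(reprK x) cechH1_addE; apply/cech_piP; set a := repr x.
apply: (@cech_equiv_add _ a _ (cov a) (fun=> setT) id id);
  [by move=> A ?; split..|].
by exists (fun=> 0) => A B *; rewrite /pull /= /pull; lia.
Qed.

Lemma cechH1_addN : left_inverse cechH1_zero cechH1_opp cechH1_add.
Proof.
move=> x; rewrite -(reprK x) cechH1_oppE cechH1_addE; apply/cech_piP.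
set a := repr x.
apply: (@cech_equiv_add (cocycle_opp a) a _ (cov a) id id (fun=> setT));
  [by move=> A ?; split..|].
by exists (fun=> 0) => A B *; rewrite /pull /= /pull; lia.
Qed.

End cech_group.

HB.instance Definition _ (X : topologicalType) :=
  GRing.isZmodule.Build (cechH1 X)
    cechH1_addA cechH1_addC cechH1_add0 cechH1_addN.

(** Induced homomorphisms *)

Section cech_functor.
Context {S T : topologicalType} (f : continuousType S T).

Section preimage_cover.
Variable U : open_cover T.

Definition preimage_members : set (set S) := [set f @^-1` B | B in U].

Lemma preimage_members_open A : preimage_members A -> open A.
Proof.
move=> [B UB <-]; apply: open_comp; first by move=> x _; exact: cts_fun.
exact: members_open UB.
Qed.

Lemma preimage_members_cover : \bigcup_(A in preimage_members) A = setT.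
Proof.
rewrite -subTset => x _.
have [B UB Bx] : (\bigcup_(A in U) A) (f x) by rewrite members_cover.
by exists (f @^-1` B) => //; exists B.
Qed.

Definition preimage_cover :=
  OpenCover preimage_members_open preimage_members_cover.

Definition preimage_proj (A : set S) : set T :=
  xget set0 [set B | members U B /\ f @^-1` B = A].

Lemma preimage_projP : projection f preimage_cover U preimage_proj.
Proof.
move=> A [B UB BA]; rewrite /preimage_proj.
by case: xgetP => [D _ [UD <-]|/(_ B)[]]; split.
Qed.

Lemma preimage_projection V p : projection f V U p ->
  projection id V preimage_cover (fun A => f @^-1` (p A)).
Proof.
by move=> pP A VA; have [UA sA] := pP _ VA; split => //; exists (p A).
Qed.

End preimage_cover.

Definition cocycle_map (a : cech_cocycle T) : cech_cocycle S :=
  @CechCocycle S (preimage_cover (cov a)) _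
    (cocycle1_pull (@preimage_projP (cov a)) (cochain_cocycle (c := a))).

Definition cechH1_map (x : cechH1 T) : cechH1 S := \pi_(cechH1 S) (cocycle_map (repr x)).

Lemma cocycle_map_equiv (a : cech_cocycle T) (b : cech_cocycle S)
    (W : open_cover S) p q :
  projection f W (cov a) p -> projection id W (cov b) q ->
  coboundary1 W (fun A B => pull p (cochain a) A B - pull q (cochain b) A B) ->
  cech_equiv (cocycle_map a) b.
Proof.
move=> pP qP h; set V := preimage_cover (cov a).
have [lZ rZ] := conj (@meetlP _ V W) (@meetrP _ V W).
exists (meet V W), (meetl V W), (q \o meetr V W); split => //.
  exact: projection_comp rZ qP.
have H1 := contiguous (projection_comp lZ (@preimage_projP (cov a)))
  (projection_comp rZ pP) (cochain_cocycle (c := a)).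
have H2 := coboundary1_pull rZ h.
by apply: eq_coboundary1 (coboundary1D H1 H2) => A B; rewrite /pull /= /pull; lia.
Qed.

Lemma cech_equiv_map a b :
  cech_equiv a b -> cech_equiv (cocycle_map a) (cocycle_map b).
Proof.
move=> [W [p [q [pP qP h]]]]; set V := preimage_cover (cov b).
set Z := meet (preimage_cover W) V.
have [lZ rZ] := conj (@meetlP _ (preimage_cover W) V)
                     (@meetrP _ (preimage_cover W) V).
have WP := projection_comp lZ (@preimage_projP W).
apply: (@cocycle_map_equiv a (cocycle_map b) Z _ _ (projection_comp WP pP) rZ).
have H1 := coboundary1_pull WP h.
have H2 := contiguous (projection_comp WP qP)
  (projection_comp rZ (@preimage_projP (cov b))) (cochain_cocycle (c := b)).
by apply: eq_coboundary1 (coboundary1D H1 H2) => A B; rewrite /pull /= /pull; lia.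
Qed.

Lemma cechH1_mapE a : cechH1_map (\pi_(cechH1 T) a) = \pi_(cechH1 S) (cocycle_map a).
Proof. by apply/cech_piP/cech_equiv_map; exact: repr_pi_equiv. Qed.

Lemma cechH1_mapD : {morph cechH1_map : x y / x + y}.
Proof.
move=> x y; rewrite -(reprK x) -(reprK y).
set a := repr x; set b := repr y.
rewrite -[LHS]/(cechH1_map (cechH1_add _ _)) -[RHS]/(cechH1_add _ _).
rewrite (cechH1_mapE a) (cechH1_mapE b) (cechH1_addE a b) cechH1_addE.
rewrite cechH1_mapE; apply/cech_piP/cech_equiv_sym.
set V := preimage_cover (cov (cocycle_add a b)).
have vP := @preimage_projP (cov (cocycle_add a b)).
have [lP rP] := conj (projection_comp vP (@meetlP _ (cov a) (cov b)))
                     (projection_comp vP (@meetrP _ (cov a) (cov b))).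
apply: (@cech_equiv_add _ (cocycle_map a) (cocycle_map b)
  (cocycle_map (cocycle_add a b)) V _ _ id
  (preimage_projection lP) (preimage_projection rP));
  first by move=> A ?; split.
have H1 := contiguous (projection_comp (preimage_projection lP)
  (@preimage_projP (cov a))) lP (cochain_cocycle (c := a)).
have H2 := contiguous (projection_comp (preimage_projection rP)
  (@preimage_projP (cov b))) rP (cochain_cocycle (c := b)).
by apply: eq_coboundary1 (coboundary1D H1 H2) => A B; rewrite /pull /= /pull; lia.
Qed.

Lemma cechH1_map_is_zmod_morphism : zmod_morphism cechH1_map.
Proof.
move=> x y; apply/(addIr (cechH1_map y)).
by rewrite -cechH1_mapD !subrK.
Qed.

HB.instance Definition _ :=
  GRing.isZmodMorphism.Build (cechH1 T) (cechH1 S) cechH1_map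
    cechH1_map_is_zmod_morphism.

End cech_functor.

(* Main.v *)
(* Let L be the space of continuous slowly oscillating real functions on X and Lb
   its subspace of bounded functions.  A circle-valued map on the compactification
   lifts over the simply connected X to a function of L, well defined up to Lb, so
   that H^1 of the compactification is L / Lb, a rational vector space.  For f in
   L the composite of f with the one-parameter subgroup R -> Sigma extends to the
   compactification; taking these maps for the members f of a rational basis B
   of L modulo Lb gives a map F into a power of Sigma.  Every circle-valued map on a
   power of Sigma is a character times the exponential of a real function, hence F
   induces an isomorphism on H^1.

   To make F injective, B is chosen to contain, for each g in L with values in
   [0, 1/2], three functions u_0 + g, u_1 + g, u_2 + g where the u_i are
   unbounded with disjoint supports.  At each point of the compactification two of
   the three values modulo 1 coincide with g, so that the three maps separate the
   points that g separates.  These functions are independent modulo Lb because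
   the u_i are sums of bumps placed along almost disjoint sets of integers, the
   codes of the prefixes of a binary sequence which determines g (X is separable). *)

Require Import Defs.
From HB Require Import structures.
From mathcomp Require Import all_boot all_order all_algebra finmap.
From mathcomp Require Import all_classical all_reals all_analysis.
From mathcomp Require Import complex zify lra ring.
Import Order.TTheory GRing.Theory Num.Theory.
Import numFieldNormedType.Exports.

Local Open Scope classical_set_scope.
Local Open Scope ring_scope.

Set Implicit Arguments.
Unset Strict Implicit.
Unset Printing Implicit Defensive.

(** * The unit circle *)

(** The two demands on F pull against each other. Points of the compactification are separated by
    bounded functions, but these vanish in L / Lb, so none of them can belong to B; g therefore
    enters B only as a perturbation of unbounded functions, which has to be undone afterwards. One
    fixed perturbation would not do: the differences for various g would be bounded and break
    independence. Hence the bumps depend on g.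

    The bumps are functions of ln (1 + d(x, x0)): they are 1-Lipschitz in that variable, and the
    logarithm varies less and less at bounded scale, so they are slowly oscillating although
    unbounded.

    The solenoid is needed because L / Lb is divisible. The n-th coordinate of F is a logarithm
    divided by (n+1)!, so every rational multiple of a member of B is seen at some level; a circle
    would see the integer multiples only.

    Cech classes and circle-valued maps are compared through the relation [represents]: classes on
    compact Hausdorff spaces are represented, circle-valued maps represent classes, and two classes
    agree exactly when the quotient of their representatives has a continuous logarithm. *)

Section circle.
Context {R : realType}.
Implicit Types (z w : R[i]) (s t : R).

(** Stated through real and imaginary parts so that limits are limits of real functions;
    [ccont_continuous] passes to the topology of [R[i]^o]. *)
Definition ccont (T : topologicalType) (f : T -> R[i]) : Prop :=
  continuous (fun x => complex.Re (f x)) /\ continuous (fun x => complex.Im (f x)).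

Definition circle_map (T : topologicalType) (f : T -> R[i]) : Prop :=
  ccont f /\ forall x, `|f x| = 1.

Definition cis t : R[i] := (cos (2 * pi * t) +i* sin (2 * pi * t))%C.

(** Principal logarithm in units of full turns; it inverts [cis] only on the open right half circle,
    with values in (-1/4, 1/4). *)
Definition clog z : R := asin (complex.Im z) / (2 * pi).

Lemma norm1P z : `|z| = 1 <-> complex.Re z ^+ 2 + complex.Im z ^+ 2 = 1.
Proof.
rewrite normc_def; split=> [/complexI h|->]; last by rewrite sqrtr1.
by rewrite -[LHS]sqr_sqrtr ?addr_ge0 ?sqr_ge0// h expr1n.
Qed.

Lemma norm1_neq0 z : `|z| = 1 -> z != 0.
Proof. by move=> z1; rewrite -normr_eq0 z1 oner_eq0. Qed.

Lemma norm1M z w : `|z| = 1 -> `|w| = 1 -> `|z * w| = 1.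
Proof. by rewrite normrM => -> ->; rewrite mulr1. Qed.

Lemma norm1V z : `|z| = 1 -> `|z^-1| = 1.
Proof. by rewrite normfV => ->; rewrite invr1. Qed.

Lemma norm1_inv z : `|z| = 1 -> z^-1 = (z^*)%C.
Proof.
move=> z1; apply: (mulfI (norm1_neq0 z1)); rewrite mulfV ?norm1_neq0//.
move/norm1P: z1; case: z => a b /= h; apply/eqP; rewrite eq_complex /=.
by apply/andP; split; apply/eqP; [rewrite -h|]; ring.
Qed.

Lemma cis_norm t : `|cis t| = 1.
Proof. by apply/norm1P; rewrite /= cos2Dsin2. Qed.

Lemma cisD s t : cis (s + t) = cis s * cis t.
Proof.
apply/eqP; rewrite eq_complex /= mulrDr sinD cosD; apply/andP; split => //.
by apply/eqP; ring.
Qed.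

Lemma cis0 : cis 0 = 1.
Proof. by rewrite /cis mulr0 cos0 sin0. Qed.

Lemma cisN t : cis (- t) = (cis t)^-1.
Proof.
apply: (mulfI (norm1_neq0 (cis_norm t))).
by rewrite -cisD subrr cis0 mulfV// norm1_neq0// cis_norm.
Qed.

Lemma cisB s t : cis (s - t) = cis s / cis t.
Proof. by rewrite cisD cisN. Qed.

Lemma cis1 : cis 1 = 1.
Proof. by rewrite /cis mulr1 mulr_natl cos2pi sin2pi. Qed.

Lemma cisMn t n : cis (t *+ n) = cis t ^+ n.
Proof.
by elim: n => [|n ih]; rewrite ?mulr0n ?cis0// mulrS cisD ih exprS.
Qed.

Lemma cis_int (m : int) : cis m%:~R = 1.
Proof.
case: m => n; rewrite ?NegzE ?mulrNz ?cisN -pmulrn cisMn cis1 expr1n//.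
by rewrite invr1.
Qed.

Lemma cisXz t (m : int) : cis t ^ m = cis (m%:~R * t).
Proof.
case: m => n; first by rewrite -pmulrn mulr_natl cisMn.
by rewrite NegzE mulrNz -pmulrn mulNr cisN mulr_natl cisMn.
Qed.

Lemma cis_sum (I : Type) (r : seq I) (h : I -> R) :
  cis (\sum_(i <- r) h i) = \prod_(i <- r) cis (h i).
Proof.
elim: r => [|i r ih]; first by rewrite !big_nil cis0.
by rewrite !big_cons cisD ih.
Qed.

(** By 1 - cos (2a) = 2 sin² a with a = pi |t|, and sin is positive on (0, pi). It serves throughout
    to show that two logarithms of the same number coincide once they differ by less than 1. *)
Lemma cis_eq1_lt t : cis t = 1 -> `|t| < 1 -> t = 0.
Proof.
move=> [c1 s0] t1; apply/eqP; rewrite -normr_eq0 eq_le normr_ge0 andbT leNgt.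
apply/negP => t0.
have p0 : 0 < pi :> R := pi_gt0 R.
have : sin (pi * `|t|) = 0.
  have : cos ((pi * `|t|) *+ 2) = 1.
    rewrite -[RHS]c1 -mulr_natl mulrA.
    by have [h|h] := ger0P t; rewrite ?mulrN ?cosN.
  rewrite cos_mulr2n => c2.
  by apply/eqP; rewrite -sqrf_eq0 sin2cos2; apply/eqP; lra.
have : 0 < sin (pi * `|t|).
  by apply: sin_gt0_pi; rewrite mulr_gt0//= gtr_pMr.
by move=> + h; rewrite h ltxx.
Qed.

Lemma cis_eq1_int t : cis t = 1 -> exists m : int, t = m%:~R.
Proof.
move=> t1; exists (Num.floor t); have /andP[h1 h2] := floor_itv t.
apply/eqP; rewrite -subr_eq0; apply/eqP/cis_eq1_lt.
  by rewrite cisB t1 cis_int divr1.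
by rewrite ger0_norm ?subr_ge0// ltrBlDl; move: h2; rewrite intrD addrC.
Qed.

Lemma Im_itv z : `|z| = 1 -> -1 <= complex.Im z <= 1.
Proof. by move=> /norm1P h; have := sqr_ge0 (complex.Re z); nra. Qed.

Lemma Re_itv z : `|z| = 1 -> -1 <= complex.Re z <= 1.
Proof. by move=> /norm1P h; have := sqr_ge0 (complex.Im z); nra. Qed.

Lemma Im_itv_strict z : `|z| = 1 -> 0 < complex.Re z -> -1 < complex.Im z < 1.
Proof. by move=> /norm1P h r0; nra. Qed.

Lemma norm1_Re_ge1 z : `|z| = 1 -> 1 <= complex.Re z -> z = 1.
Proof.
move=> z1 r1; have /andP[_ r2] := Re_itv z1; move/norm1P: z1.
case: z r1 r2 => a b /= a1 a2.
have -> : a = 1 by apply/eqP; rewrite eq_le a1 a2.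
rewrite expr1n => h; have /eqP : b ^+ 2 = 0 by lra.
by rewrite sqrf_eq0 => /eqP ->.
Qed.

Lemma clogK z : `|z| = 1 -> 0 < complex.Re z -> cis (clog z) = z.
Proof.
move=> z1 r0; have p0 : 2 * pi != 0 :> R by rewrite mulf_neq0 ?gt_eqF ?pi_gt0.
rewrite /cis /clog (mulrC (asin _)) mulVKf//.
rewrite asinK ?in_itv/= ?Im_itv// cos_asin ?Im_itv//.
move/norm1P: z1; case: z r0 => a b /= r0 h.
by rewrite (_ : 1 - b ^+ 2 = a ^+ 2) ?sqrtr_sqr ?gtr0_norm//; lra.
Qed.

Lemma clog_lt z : `|z| = 1 -> 0 < complex.Re z -> `|clog z| < 4^-1.
Proof.
move=> z1 r0; have p0 := pi_gt0 R.
have /andP[h1 h2] := Im_itv_strict z1 r0.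
rewrite /clog ltr_norml ltr_pdivrMr ?ltr_pdivlMr ?mulr_gt0//.
have := @asin_gtNpi2 R (complex.Im z); have := @asin_ltpi2 R (complex.Im z).
rewrite h1 h2 !ltW// => /(_ isT) + /(_ isT).
by move=> *; apply/andP; split; lra.
Qed.

Lemma cis_clog t : `|t| < 4^-1 -> clog (cis t) = t.
Proof.
have p0 := pi_gt0 R; rewrite ltr_norml => /andP[h1 h2].
rewrite /clog sinK; first by rewrite mulrC mulKf// mulf_neq0 ?gt_eqF.
by rewrite in_itv /=; apply/andP; split; nra.
Qed.

Lemma clog1 : clog (1 : R[i]) = 0.
Proof. by rewrite -cis0 cis_clog// normr0 invr_gt0. Qed.

(** The arccosine of the real part gives the angle on the upper half circle; conjugation, which is t
    -> 1 - t, gives the lower half. *)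
Lemma cis_surj z : `|z| = 1 -> exists2 t, 0 <= t <= 1 & cis t = z.
Proof.
move=> z1; have p0 := pi_gt0 R; have r1 := Re_itv z1.
have a0 := acos_ge0 r1; have a1 := acos_lepi r1.
have c1 : cos (acos (complex.Re z)) = complex.Re z.
  by rewrite acosK// in_itv.
have s1 := sin_acos r1.
have /norm1P z1' := z1.
have p2 : 2 * pi != 0 :> R by rewrite mulf_neq0 ?gt_eqF.
have q1 : 0 <= acos (complex.Re z) / (2 * pi) <= 1.
  rewrite ler_pdivrMr ?ler_pdivlMr ?mulr_gt0//.
  by apply/andP; split; lra.
have cE : cis (acos (complex.Re z) / (2 * pi))
          = (complex.Re z +i* `|complex.Im z|)%C.
  rewrite /cis [acos _ / _]mulrC mulVKf// c1 s1; congr (_ +i* _)%C.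
  by rewrite (_ : 1 - _ = complex.Im z ^+ 2) ?sqrtr_sqr//; lra.
have [i0|i0] := leP 0 (complex.Im z).
  by exists (acos (complex.Re z) / (2 * pi)) => //; rewrite cE ger0_norm//; case: (z).
exists (1 - acos (complex.Re z) / (2 * pi)); first by lra.
rewrite cisB cis1 div1r norm1_inv ?cis_norm// cE ltr0_norm//=.
by rewrite opprK; case: (z).
Qed.

End circle.

Section circle_maps.
Context {R : realType}.
Implicit Types (T : topologicalType).

Lemma circle_map_norm T (f : T -> R[i]) x : circle_map f -> `|f x| = 1.
Proof. by case. Qed.

Lemma circle_mapM T (f g : T -> R[i]) :
  circle_map f -> circle_map g -> circle_map (fun x => f x * g x).
Proof.
move=> [[rf imf] nf] [[rg img] ng]; split; last by move=> x; exact: norm1M.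
have E x : f x * g x =
  ((complex.Re (f x) * complex.Re (g x) - complex.Im (f x) * complex.Im (g x)) +i*
   (complex.Re (f x) * complex.Im (g x) + complex.Im (f x) * complex.Re (g x)))%C.
  by case: (f x) => a b; case: (g x) => c d.
split => x; under eq_fun do rewrite E /=.
  by apply: cvgB; apply: cvgM; [exact: rf|exact: rg|exact: imf|exact: img].
by apply: cvgD; apply: cvgM; [exact: rf|exact: img|exact: imf|exact: rg].
Qed.

Lemma circle_mapV T (f : T -> R[i]) :
  circle_map f -> circle_map (fun x => (f x)^-1).
Proof.
move=> [[rf imf] nf]; split; last by move=> x; exact: norm1V.
have E x : (f x)^-1 = (complex.Re (f x) -i* complex.Im (f x))%C.
  by rewrite norm1_inv//; case: (f x).
split => x; under eq_fun do rewrite E /=; first exact: rf.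
by apply: cvgN; exact: imf.
Qed.

Lemma circle_map_div T (f g : T -> R[i]) :
  circle_map f -> circle_map g -> circle_map (fun x => f x / g x).
Proof. by move=> cf /circle_mapV; exact: circle_mapM. Qed.

Lemma circle_map_comp (S T : topologicalType) (f : T -> R[i]) (h : S -> T) :
  continuous h -> circle_map f -> circle_map (fun x => f (h x)).
Proof.
move=> ch [[rf imf] nf]; split => //.
split=> x; first exact: (continuous_comp (ch x) (rf (h x))).
exact: (continuous_comp (ch x) (imf (h x))).
Qed.

Lemma circle_map_cst T (z : R[i]) : `|z| = 1 -> circle_map (fun _ : T => z).
Proof. by move=> z1; split => //; split=> x; exact: cvg_cst. Qed.

Lemma circle_mapXn T (f : T -> R[i]) n :
  circle_map f -> circle_map (fun x => f x ^+ n).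
Proof.
move=> cf; elim: n => [|n ih]; first exact: circle_map_cst (normr1 _).
by under eq_fun do rewrite exprS; exact: circle_mapM.
Qed.

Lemma circle_mapXz T (f : T -> R[i]) (m : int) :
  circle_map f -> circle_map (fun x => f x ^ m).
Proof.
case: m => n cf; first exact: circle_mapXn.
by apply: circle_mapV; exact: circle_mapXn.
Qed.

Lemma circle_map_prod T (I : Type) (s : seq I) (f : I -> T -> R[i]) :
  (forall i, circle_map (f i)) -> circle_map (fun x => \prod_(i <- s) f i x).
Proof.
move=> cf; elim: s => [|i s ih].
  by under eq_fun do rewrite big_nil; exact: circle_map_cst (normr1 _).
by under eq_fun do rewrite big_cons; exact: circle_mapM.
Qed.

Lemma circle_map_cis T (f : T -> R) :
  continuous f -> circle_map (fun x => cis (f x)).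
Proof.
move=> cf; split; last by move=> x; exact: cis_norm.
have c2 (x : T) : (fun y => 2 * pi * f y) @ x --> 2 * pi * f x.
  by apply: cvgM; [exact: cvg_cst|exact: cf].
split => x.
  exact: (continuous_comp (c2 x) (@continuous_cos R _)).
exact: (continuous_comp (c2 x) (@continuous_sin R _)).
Qed.

Lemma clog_continuous T (f : T -> R[i]) x : circle_map f ->
  0 < complex.Re (f x) -> {for x, continuous (fun y => clog (f y))}.
Proof.
move=> [[rf imf] nf] r0; apply: cvgM; last exact: cvg_cst.
apply: (continuous_comp (imf x)).
by apply: continuous_asin; exact: Im_itv_strict.
Qed.

End circle_maps.

(** * Lifting of homotopies *)

Section continuity.
Context {S T U : topologicalType}.

Lemma continuous_composition (f : S -> T) (g : T -> U) :
  continuous f -> continuous g -> continuous (fun x => g (f x)).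
Proof. by move=> cf cg x; exact: (continuous_comp (cf x) (cg (f x))). Qed.

Lemma continuous_pair (f : S -> T) (g : S -> U) :
  continuous f -> continuous g -> continuous (fun x => (f x, g x)).
Proof. by move=> cf cg x; apply: cvg_pair; [exact: cf|exact: cg]. Qed.

Lemma continuous_fst : continuous (@fst S T).
Proof. by move=> x; exact: cvg_fst. Qed.

Lemma continuous_snd : continuous (@snd S T).
Proof. by move=> x; exact: cvg_snd. Qed.

End continuity.

Section continuous_real.
Context {R : realType} {T : topologicalType}.
Implicit Types f g : T -> R.

Lemma continuous_addr f g :
  continuous f -> continuous g -> continuous (fun x => f x + g x).
Proof. by move=> cf cg x; apply: cvgD; [exact: cf|exact: cg]. Qed.

Lemma continuous_subr f g :
  continuous f -> continuous g -> continuous (fun x => f x - g x).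
Proof. by move=> cf cg x; apply: cvgB; [exact: cf|exact: cg]. Qed.

Lemma continuous_mulr f g :
  continuous f -> continuous g -> continuous (fun x => f x * g x).
Proof. by move=> cf cg x; apply: cvgM; [exact: cf|exact: cg]. Qed.

Lemma continuous_oppr f : continuous f -> continuous (fun x => - f x).
Proof. by move=> cf x; apply: cvgN; exact: cf. Qed.

Lemma continuous_normr f : continuous f -> continuous (fun x => `|f x|).
Proof. by move=> cf x; apply: cvg_norm; exact: cf. Qed.

Lemma continuous_sumr (I : Type) (s : seq I) (h : I -> T -> R) :
  (forall i, continuous (h i)) -> continuous (fun x => \sum_(i <- s) h i x).
Proof.
by move=> ch x; apply: cvg_big => [|i _]; [exact: add_continuous|exact: ch].
Qed.

End continuous_real.

Lemma compact_finite_cover (T : topologicalType) (C : set T) :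
  compact C -> cover_compact C.
Proof.
have [->|/set0P[x Cx]] := eqVneq C set0.
  by move=> _ I D f _ _; exists fset0 => // ?; rewrite inE.
pose pT : ptopologicalType := HB.pack (T : Type) (Topological.on T)
  (isPointed.Build T x).
by move=> cC; have : @compact pT C := cC; rewrite compact_cover.
Qed.

Section uniform_control.
Context {R : realType}.

(** Wherever D >= e on C, some [d i] is positive; so C is covered by the open sets {D < e} and
    {1/(n+1) < d i}, and a finite subcover provides [s] and [n]. It turns a statement about all
    coordinates into one about finitely many of them. *)
Lemma uniform_control (T : topologicalType) (C : set T) (I : choiceType)
    (d : I -> T -> R) (D : T -> R) (e : R) :
  compact C -> (forall i, continuous (d i)) -> continuous D ->
  (forall p, C p -> (forall i, d i p <= 0) -> D p < e) ->
  exists (s : seq I) (n : nat),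
    forall p, C p -> (forall i, i \in s -> d i p < n.+1%:R^-1) -> D p < e.
Proof.
move=> /compact_finite_cover cC cd cD h.
pose f (o : option (I * nat)) : set T :=
  if o is Some (i, n) then [set p | n.+1%:R^-1 < d i p] else [set p | D p < e].
have fo o : setT o -> open (f o).
  case: o => [[i n]|] _ /=.
    exact: (@open_comp _ _ (d i) [set x | n.+1%:R^-1 < x] (fun p _ => cd i p)
      (@open_gt _ _)).
  exact: (@open_comp _ _ D [set x | x < e] (fun p _ => cD p) (@open_lt _ _)).
have Cf : C `<=` cover setT f.
  move=> p Cp; have [De|De] := ltP (D p) e; first by exists None.
  have [i di] : exists i, 0 < d i p.
    apply: contrapT => /forallNP no; move: De; apply/negP; rewrite -ltNge.
    by apply: h => // i; rewrite leNgt; exact/negP/no.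
  have [n /= hn] := filter_ex (near_infty_natSinv_lt (PosNum di)).
  by exists (Some (i, n)).
have [E _ CE] := cC _ setT f fo Cf.
pose s := pmap id (enum_fset E).
(* The largest n of the subcover gives the smallest threshold, below all those in use. *)
exists [seq x.1 | x <- s], (\max_(x <- s) x.2)%N => p Cp ds.
have [[[i n]|] //= Ein fip] := CE p Cp.
have si : (i, n) \in s by rewrite mem_pmap map_id.
have := ds i (map_f _ si); rewrite ltNge => /negP[]; apply: ltW.
apply: le_lt_trans fip; rewrite lef_pV2 ?posrE ?ltr0n// ler_nat ltnS.
exact: (@leq_bigmax_seq _ s xpredT (fun x : I * nat => x.2) (i, n) si isT).
Qed.

(** The retraction of R onto [0, 1], written with absolute values to make continuity immediate. It
    makes maps given only on [0, 1] globally continuous. *)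
Definition clamp (u : R) : R := (1 + `|u| - `|u - 1|) / 2.

Lemma clamp_id u : 0 <= u <= 1 -> clamp u = u.
Proof.
move=> /andP[u0 u1]; rewrite /clamp (ger0_norm u0).
by rewrite distrC (@ger0_norm _ (1 - u)) ?subr_ge0//; field.
Qed.

Lemma clamp_itv u : 0 <= clamp u <= 1.
Proof.
rewrite /clamp.
by have [?|?] := ler0P u; have [?|?] := ler0P (u - 1); apply/andP; split; lra.
Qed.

Lemma clamp_continuous : continuous clamp.
Proof.
move=> u; apply: cvgM; last exact: cvg_cst.
apply: cvgB; first by apply: cvgD; [exact: cvg_cst|exact: norm_continuous].
by apply: cvg_norm; apply: cvgB; [exact: cvg_id|exact: cvg_cst].
Qed.

Lemma homotopy_steps (K : topologicalType) (C : set K) (h : K -> R -> R[i]) :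
  compact C -> circle_map (fun p : K * R => h p.1 p.2) ->
  exists n : nat, forall k (u v : R), C k -> 0 <= u <= 1 -> 0 <= v <= 1 ->
    `|u - v| <= n.+1%:R^-1 -> 0 < complex.Re (h k u / h k v).
Proof.
move=> cC ch.
have [||||s [n hn]] := @uniform_control (K * (R * R))%type
    (C `*` (`[0, 1]%classic `*` `[0, 1]%classic)) unit
    (fun _ p => `|p.2.1 - p.2.2|)
    (fun p => - complex.Re (h p.1 p.2.1 / h p.1 p.2.2)) 0.
- by apply: compact_setX => //; apply: compact_setX; exact: segment_compact.
- move=> _ p; apply: cvg_norm; apply: cvgB.
    exact: (continuous_composition continuous_snd continuous_fst).
  exact: (continuous_composition continuous_snd continuous_snd).
- move=> p; apply: cvgN.
  have [] := @circle_map_div R _ (fun p : K * (R * R) => h p.1 p.2.1)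
      (fun p : K * (R * R) => h p.1 p.2.2); last by move=> [+ _] _; exact.
    have c1 : continuous (fun p : K * (R * R) => (p.1, p.2.1)).
      apply: continuous_pair; first exact: continuous_fst.
      exact: (continuous_composition continuous_snd continuous_fst).
    exact: (circle_map_comp c1 ch).
  have c2 : continuous (fun p : K * (R * R) => (p.1, p.2.2)).
    apply: continuous_pair; first exact: continuous_fst.
    exact: (continuous_composition continuous_snd continuous_snd).
  exact: (circle_map_comp c2 ch).
- move=> [k [u v]] /= _ /(_ tt); rewrite normr_le0 subr_eq0 => /eqP ->.
  have := circle_map_norm (k, v) ch => /= n1.
  by rewrite divff ?norm1_neq0//= oppr_lt0.
(* One more than [n], to turn the non-strict bound on [|u - v|] into the strict one of [hn]. *)
exists n.+1 => k u v Ck u01 v01 uv; rewrite -oppr_lt0.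
apply: (hn (k, (u, v))); first by split => //=; split; rewrite /= in_itv.
move=> _ _ /=; apply: le_lt_trans uv _.
by rewrite ltf_pV2 ?posrE ?ltr0n// ltr_nat.
Qed.

(* A path in the circle cut into steps shorter than a quarter turn is lifted by
   summing the principal logarithms of the successive ratios. *)
Lemma homotopy_lift (K : topologicalType) (h : K -> R -> R[i]) (n : nat) :
  circle_map (fun p : K * R => h p.1 p.2) ->
  (forall k (u v : R), 0 <= u <= 1 -> 0 <= v <= 1 ->
    `|u - v| <= n.+1%:R^-1 -> 0 < complex.Re (h k u / h k v)) ->
  exists L : K -> R -> R, [/\ continuous (fun p : K * R => L p.1 p.2),
    forall k, L k 0 = 0 &
    forall k (u : R), 0 <= u <= 1 -> h k u = h k 0 * cis (L k u)].
Proof.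
move=> ch hn; set N := n.+1%:R : R in hn *.
have N0 : 0 < N by rewrite ltr0n.
(* The point [q j u] lies j/N of the way from 0 to u. Clamping u keeps the steps short, and [L]
   continuous, for every real u. *)
pose q (j : nat) (u : R) : R := clamp u * (j%:R / N).
have q01 j u : (j <= n.+1)%N -> 0 <= q j u <= 1.
  move=> jn; have /andP[c0 c1] := clamp_itv u.
  have j0 : 0 <= (j%:R / N : R) by rewrite divr_ge0// ltW.
  have j1 : (j%:R / N : R) <= 1 by rewrite ler_pdivrMr// mul1r ler_nat.
  by rewrite mulr_ge0//= mulr_ile1.
have qq j u : `|q j.+1 u - q j u| <= N^-1.
  have /andP[c0 c1] := clamp_itv u.
  rewrite /q -mulrBr -mulrBl -natrB// subSn// subnn mul1r normrM.
  by rewrite !ger0_norm ?invr_ge0 ?(ltW N0)// ler_piMl ?invr_ge0 ?(ltW N0).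
have qc j : continuous (fun p : K * R => (p.1, q j p.2)).
  apply: continuous_pair; first exact: continuous_fst.
  move=> p; apply: cvgM; last exact: cvg_cst.
  exact: (continuous_composition continuous_snd clamp_continuous).
pose L k u := \sum_(j < n.+1) clog (h k (q j.+1 u) / h k (q j u)).
have h1 k u : `|h k u| = 1 by exact: (circle_map_norm (k, u) ch).
have rpos (j : 'I_n.+1) k u : 0 < complex.Re (h k (q j.+1 u) / h k (q j u)).
  by apply: hn; [apply: q01..|exact: qq]; [exact: ltn_ord|exact: ltnW].
exists L; split.
- move=> p; rewrite /L; apply: cvg_big => [|j _]; first exact: add_continuous.
  have := @clog_continuous R _ (fun p : K * R => h p.1 (q j.+1 p.2) / h p.1 (q j p.2)) p.
  apply => //; apply: circle_map_div.
    exact: (circle_map_comp (qc j.+1) ch).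
  exact: (circle_map_comp (qc j) ch).
- move=> k; rewrite /L big1// => j _.
  rewrite /q clamp_id ?lexx ?ler01// !mul0r divff ?norm1_neq0//.
  by rewrite clog1.
- move=> k u u01; rewrite /L.
  have tel m : (m <= n.+1)%N -> h k (q m u) =
      h k 0 * cis (\sum_(0 <= j < m) clog (h k (q j.+1 u) / h k (q j u))).
    elim: m => [_|m ih mn]; first by rewrite big_nil cis0 mulr1 /q mul0r mulr0.
    rewrite big_nat_recr//= cisD mulrA -ih ?(ltnW mn)//.
    rewrite clogK ?(rpos (Ordinal mn))//; first by rewrite mulrC divfK// norm1_neq0.
    by apply: norm1M => //; apply: norm1V.
  have := tel n.+1 (leqnn _); rewrite big_mkord => <-.
  by rewrite /q divff ?gt_eqF// mulr1 clamp_id.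
Qed.

End uniform_control.

Section integer_valued.
Context {R : realType}.

Lemma connected_int_cst (T : topologicalType) (C : set T) (f : T -> R) :
  connected C -> continuous f -> (forall x, C x -> cis (f x) = 1) ->
  forall x y, C x -> C y -> f x = f y.
Proof.
move=> cC cf f1 x y Cx Cy.
have := connected_continuous_connected cC (continuous_subspaceT cf).
move/connected_intervalP => itv.
wlog xy : x y Cx Cy / f x <= f y.
  by move=> w; have [/w->|/ltW /w ->] := leP (f x) (f y).
apply/eqP; rewrite eq_le xy leNgt; apply/negP => lxy.
(* A value of f at distance in (0, 1) from [f x], or equal to [f y] if that is closer than 1/2: two
   logarithms of 1 cannot be that close. *)
have [z Cz zE] : (f @` C) (Num.min (f x + 2^-1) (f y)).
  apply: (itv (f x) (f y)); [by exists x|by exists y|].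
  by rewrite ge_min lexx orbT le_min xy lerDl invr_ge0 ler0n.
have := @cis_eq1_lt R (f z - f x); rewrite cisB !f1// divr1 => /(_ erefl).
rewrite zE; case: (leP (f x + 2^-1) (f y)) => h.
  rewrite addrC addKr ger0_norm ?invr_ge0// => h'.
  have : 2^-1 < 1 :> R by rewrite invf_lt1// ltr1n.
  by move/h'/eqP; rewrite invr_eq0 pnatr_eq0.
rewrite gtr0_norm ?subr_gt0// => h'.
suff /h' : f y - f x < 1 by lra.
by lra.
Qed.

End integer_valued.

(** * Cech classes and circle-valued maps *)

Lemma continuous_near_eq (S T : topologicalType) (f g : S -> T) (x : S) :
  (\forall y \near x, f y = g y) -> {for x, continuous g} ->
  {for x, continuous f}.
Proof.
move=> fg cg; have fx : f x = g x := nbhs_singleton fg.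
change (f @ x --> f x); rewrite fx; apply: cvg_trans cg.
by apply: near_eq_cvg; apply: filterS fg => y ->.
Qed.

Section representation.
Context {R : realType}.
Implicit Types (K : topologicalType).

(* The circle-valued map [f] represents the class of [a]: over the members of
   the cover it has logarithms [phi] whose differences are the values of the
   cochain. *)
Definition represents K (a : cech_cocycle K) (f : K -> R[i]) : Prop :=
  exists phi : set K -> K -> R,
    [/\ forall A x, members (cov a) A -> A x -> {for x, continuous (phi A)},
        forall A x, members (cov a) A -> A x -> cis (phi A x) = f x &
        forall A B x, members (cov a) A -> members (cov a) B -> A x -> B x ->
          phi B x - phi A x = (cochain a A B)%:~R].

Lemma cover_ex K (U : open_cover K) x : exists2 A, members U A & A x.
Proof.
by have [A UA Ax] : (\bigcup_(A in U) A) x by [rewrite members_cover]; exists A.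
Qed.

Lemma member_nbhs K (U : open_cover K) A x : members U A -> A x -> nbhs x A.
Proof. by move=> UA Ax; apply: open_nbhs_nbhs; split => //; exact: members_open UA. Qed.

(** The local differences of logarithms, corrected by the integers [beta] of the coboundary, agree
    on overlaps and glue to a global function. *)
Lemma represents_equiv K (a b : cech_cocycle K) (f g : K -> R[i]) :
  represents a f -> represents b g -> cech_equiv a b ->
  exists2 r : K -> R, continuous r & forall x, f x = g x * cis (r x).
Proof.
move=> [phi [cphi fphi dphi]] [psi [cpsi gpsi dpsi]] [W [p [q [pP qP [beta hb]]]]].
have [w wP] : {w : K -> set K & forall x, members W (w x) /\ w x x}.
  apply: (@choice _ _ (fun x A => members W A /\ A x)) => x.
  by have [A WA Ax] := cover_ex W x; exists A.
pose r' A x := phi (p A) x - psi (q A) x - (beta A)%:~R.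
have rE A B x : members W A -> members W B -> A x -> B x -> r' A x = r' B x.
  move=> WA WB Ax Bx; have [[Up sp] [Vq sq]] := conj (pP _ WA) (qP _ WA).
  have [[Up' sp'] [Vq' sq']] := conj (pP _ WB) (qP _ WB).
  have h1 := dphi _ _ _ Up Up' (sp _ Ax) (sp' _ Bx).
  have h2 := dpsi _ _ _ Vq Vq' (sq _ Ax) (sq' _ Bx).
  have /(congr1 (fun m : int => m%:~R : R)) := hb _ _ WA WB (ex_intro _ x (conj Ax Bx)).
  rewrite /pull !intrB -h1 -h2 /r' => h3; lra.
exists (fun x => r' (w x) x) => x; have [Ww wx] := wP x.
- apply: (@continuous_near_eq _ _ _ (r' (w x))).
    have := member_nbhs Ww wx; apply: filterS => y wy.
    by have [Wy wyy] := wP y; exact: rE.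
  have [[Up sp] [Vq sq]] := conj (pP _ Ww) (qP _ Ww).
  apply: cvgB; last exact: cvg_cst.
  by apply: cvgB; [exact: (cphi _ _ Up (sp _ wx))|exact: (cpsi _ _ Vq (sq _ wx))].
- have [[Up sp] [Vq sq]] := conj (pP _ Ww) (qP _ Ww).
  rewrite -(fphi _ _ Up (sp _ wx)) -(gpsi _ _ Vq (sq _ wx)) /r'.
  by rewrite !cisB cis_int divr1 mulrC divfK// norm1_neq0// cis_norm.
Qed.

(** On the intersection of a member of one cover with a member of the other, [phi A - psi B - r] is
    integer-valued, hence locally constant. Cutting along its values refines both covers, and the
    integer itself is the 0-cochain whose coboundary is the difference. *)
Lemma equiv_represents K (a b : cech_cocycle K) (f g : K -> R[i]) (r : K -> R) :
  represents a f -> represents b g -> continuous r ->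
  (forall x, f x = g x * cis (r x)) -> cech_equiv a b.
Proof.
move=> [phi [cphi fphi dphi]] [psi [cpsi gpsi dpsi]] cr fg.
pose s A B x := phi A x - psi B x - r x.
have cs A B x : members (cov a) A -> members (cov b) B -> A x -> B x -> {for x, continuous (s A B)}.
  move=> aA bB Ax Bx; apply: cvgB; last exact: cr.
  by apply: cvgB; [exact: cphi|exact: cpsi].
have s1 A B x : members (cov a) A -> members (cov b) B -> A x -> B x -> cis (s A B x) = 1.
  move=> aA bB Ax Bx; rewrite /s !cisB fphi// gpsi// fg.
  have n1 : g x != 0 by rewrite -(gpsi _ _ bB Bx) norm1_neq0// cis_norm.
  by rewrite mulrAC mulfK ?divff// norm1_neq0// cis_norm.
pose P D (t : set K * set K * int) := [/\ members (cov a) t.1.1, members (cov b) t.1.2 &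
  D = [set x | [/\ t.1.1 x, t.1.2 x & s t.1.1 t.1.2 x = t.2%:~R]]].
pose Z : set (set K) := [set D | exists t, P D t].
have Zo D : Z D -> open D.
  move=> [[[A B] m] [/= aA bB ->]]; rewrite openE => x [/= Ax Bx sx].
  have near1 : \forall y \near x, `|s A B x - s A B y| < 1.
    by have /cvgrPdist_lt := cs _ _ _ aA bB Ax Bx; apply.
  rewrite /interior; near=> y.
  have Ay : A y by near: y; exact: member_nbhs aA Ax.
  have By : B y by near: y; exact: member_nbhs bB Bx.
  split => //; apply/eqP; rewrite -subr_eq0 -opprB oppr_eq0 -sx; apply/eqP.
  apply: cis_eq1_lt; last by near: y.
  by rewrite cisB !s1// divr1.
have Zc : \bigcup_(D in Z) D = setT.
  rewrite -subTset => x _; have [A aA Ax] := cover_ex (cov a) x.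
  have [B bB Bx] := cover_ex (cov b) x.
  have [m mE] := cis_eq1_int (s1 _ _ _ aA bB Ax Bx).
  exists [set x | [/\ A x, B x & s A B x = m%:~R]] => //.
  by exists (A, B, m).
(* One set may arise from several triples; a choice fixes the projections and the 0-cochain
   together. *)
have [t tP] : {t : set K -> set K * set K * int & forall D, Z D -> P D (t D)}.
  apply: (@choice _ _ (fun D t => Z D -> P D t)) => D.
  have [[u uP]|nZ] := pselect (Z D); first by exists u.
  by exists (set0, set0, 0) => /nZ.
exists (OpenCover Zo Zc), (fun D => (t D).1.1), (fun D => (t D).1.2); split.
- by move=> D /tP [aA bB DE]; split => // x; rewrite {1}DE => -[].
- by move=> D /tP [aA bB DE]; split => // x; rewrite {1}DE => -[].
exists (fun D => (t D).2) => D E /tP [aA bB DE] /tP [aA' bB' EE] [x []].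
rewrite {1}DE {1}EE => -[Ax Bx sx] [A'x B'x s'x].
apply: (@intr_inj R); rewrite /pull !intrB -sx -s'x -(dphi _ _ x)// -(dpsi _ _ x)//.
by rewrite /s; lra.
Unshelve. all: by end_near. Qed.

Lemma represents_map (S T : topologicalType) (h : continuousType S T)
    (a : cech_cocycle T) (f : T -> R[i]) :
  represents a f -> represents (cocycle_map h a) (f \o h).
Proof.
move=> [phi [cphi fphi dphi]].
exists (fun A x => phi (preimage_proj h (cov a) A) (h x)); split.
- move=> A x UA Ax; have [aA sA] := preimage_projP UA.
  apply: (@continuous_comp _ _ _ h); first exact: cts_fun.
  by apply: cphi => //; exact: sA.
- move=> A x UA Ax; have [aA sA] := preimage_projP UA.
  by apply: fphi => //; exact: sA.
- move=> A B x UA UB Ax Bx; have [aA sA] := preimage_projP UA.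
  have [aB sB] := preimage_projP UB.
  by apply: dphi => //; [exact: sA|exact: sB].
Qed.

(** The cover consists of the preimages of the open half circles, on each of which the principal
    branch around the centre is a logarithm. *)
Lemma represents_ex K (f : K -> R[i]) : circle_map f ->
  exists a : cech_cocycle K, represents a f.
Proof.
move=> cf.
pose P A (t : R) := A = [set y | 0 < complex.Re (f y / cis t)].
pose U : set (set K) := [set A | exists t, P A t].
have cg t : circle_map (fun y => f y / cis t).
  by apply: circle_map_div => //; apply: circle_map_cst; exact: cis_norm.
have Uo A : U A -> open A.
  move=> [t ->].
  have [[cr _] _] := cg t.
  exact: (@open_comp _ _ (fun y => complex.Re (f y / cis t)) [set x | 0 < x]
    (fun p _ => cr p) (@open_gt _ _)).
have Uc : \bigcup_(A in U) A = setT.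
  rewrite -subTset => x _; have [t _ tE] := cis_surj (circle_map_norm x cf).
  exists [set y | 0 < complex.Re (f y / cis t)]; first by exists t.
  by rewrite /= tE divff ?ltr01// -tE norm1_neq0// cis_norm.
have [t tP] : {t : set K -> R & forall A, U A -> P A (t A)}.
  apply: (@choice _ _ (fun D t => U D -> P D t)) => D.
  have [[u uP]|nZ] := pselect (U D); first by exists u.
  by exists 0 => /nZ.
pose phi A x := t A + clog (f x / cis (t A)).
have phiE A x : U A -> A x -> cis (phi A x) = f x.
  move=> UA; rewrite {1}(tP _ UA) /= => h.
  rewrite /phi cisD clogK//; last exact: (circle_map_norm x (cg _)).
  by rewrite mulrC divfK// norm1_neq0// cis_norm.
pose c A B : int := xget 0 [set m : int | exists x, [/\ A x, B x & phi B x - phi A x = m%:~R]].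
have phi_lt A x : U A -> A x -> `|phi A x - t A| < 4^-1.
  move=> UA; rewrite {1}(tP _ UA) /= => h.
  by rewrite /phi addrC addKr; apply: clog_lt => //; exact: (circle_map_norm x (cg _)).
(* Each of the four logarithms is within 1/4 of the centre of its branch, so the difference at x and
   that at y differ by less than 1. The integer is thus the same on all of the intersection, even if
   this is disconnected. *)
have cE A B x : U A -> U B -> A x -> B x -> phi B x - phi A x = (c A B)%:~R.
  move=> UA UB Ax Bx; rewrite /c; case: xgetP => [n _ [y [Ay By <-]]|/=].
    apply/eqP; rewrite -subr_eq0; apply/eqP/cis_eq1_lt.
      have nf z : f z != 0 by rewrite norm1_neq0//; exact: circle_map_norm.
      by rewrite !cisB !phiE// !divff// divr1.
    have := phi_lt _ _ UA Ax; have := phi_lt _ _ UB Bx.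
    have := phi_lt _ _ UA Ay; have := phi_lt _ _ UB By.
    rewrite !ltr_norml => /andP[? ?] /andP[? ?] /andP[? ?] /andP[? ?].
    by apply/andP; split; lra.
  have t1 : cis (phi B x - phi A x) = 1.
    by rewrite cisB !phiE// divff// norm1_neq0//; exact: circle_map_norm.
  have [m mE] := cis_eq1_int t1.
  by move=> /(_ m) []; exists x.
have cc : cocycle1 U c.
  move=> A B C UA UB UC [x [[Ax Bx] Cx]]; apply: (@intr_inj R).
  rewrite intrD intrB -(cE _ _ x)// -(cE _ _ x)// -(cE _ _ x)//; lra.
exists (@CechCocycle K (OpenCover Uo Uc) c cc), phi; split => //.
move=> A x /= UA Ax; apply: cvgD; first exact: cvg_cst.
by apply: clog_continuous => //; move: Ax; rewrite {1}(tP _ UA).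
Qed.

(** A partition of unity solves the cocycle over the reals: [phi A] is the average of the integers
    c(w x, A), and the cocycle identity on (w x, A, B) gives [phi B - phi A] = c(A, B). Modulo 1 the
    [phi A] then define one global map. *)
Lemma cocycle_represents K (a : cech_cocycle K) :
  compact [set: K] -> hausdorff_space K ->
  exists2 f : K -> R[i], circle_map f & represents a f.
Proof.
move=> cK hK.
have sepU (x : K) (A : set K) : open A -> A x -> exists u : K -> R,
    [/\ continuous u, forall y, 0 <= u y, 0 < u x & forall y, ~ A y -> u y = 0].
  move=> oA Ax; have nK := compact_normal hK cK.
  have aK := hausdorff_accessible hK.
  have := @normal_completely_regular R K nK aK x (~` A) (open_closedC oA) (fun h => h Ax).
  move=> /(@uniform_separatorP _ R) [u [cu u01 u0 u1]].
  exists (fun y => 1 - u y); split.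
  - by move=> y; apply: cvgB; [exact: cvg_cst|exact: cu].
  - move=> y; have := u01 (u y) (ex_intro2 _ _ y I erefl).
    by rewrite /= in_itv /= subr_ge0 => /andP[].
  - by rewrite (u0 (u x)) ?subr0//; exists x.
  - by move=> y nA; rewrite (u1 (u y)) ?subrr//; exists y.
have [w wP] : {w : K -> set K & forall x, members (cov a) (w x) /\ w x x}.
  apply: (@choice _ _ (fun x A => members (cov a) A /\ A x)) => x.
  by have [A WA Ax] := cover_ex (cov a) x; exists A.
have [u uP] := choice (fun x => sepU x (w x) (members_open (wP x).1) (wP x).2).
have uo x : setT x -> open [set y | 0 < u x y].
  have [cu _ _ _] := uP x => _.
  exact: (@open_comp _ _ (u x) [set x | 0 < x] (fun p _ => cu p) (@open_gt _ _)).
have [E _ KE] := compact_finite_cover cK uo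
  (fun x _ => ex_intro2 _ _ x I (let: And4 _ _ h _ := uP x in h)).
pose s := enum_fset E.
pose den y := \sum_(x <- s) u x y.
have u0 x y : 0 <= u x y by case: (uP x).
have den0 y : 0 < den y.
  have [x /= xE uxy] := KE y I; rewrite /den (big_rem x xE) /=.
  by apply: ltr_wpDr => //; apply: sumr_ge0.
pose phi A y : R := (\sum_(x <- s) u x y * (cochain a (w x) A)%:~R) / den y.
have cden : continuous den.
  move=> y; apply: cvg_big => [|x _]; first exact: add_continuous.
  by case: (uP x) => + _ _ _; exact.
have cphi A : continuous (phi A).
  move=> y; apply: cvgM; last by apply: cvgV; [rewrite gt_eqF|exact: cden].
  apply: cvg_big => [|x _]; first exact: add_continuous.
  by apply: cvgM; [case: (uP x) => + _ _ _; exact|exact: cvg_cst].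
have dphi A B x : members (cov a) A -> members (cov a) B -> A x -> B x ->
    phi B x - phi A x = (cochain a A B)%:~R.
  move=> aA aB Ax Bx; rewrite /phi -mulrBl -sumrB.
  apply: (mulIf (lt0r_neq0 (den0 x))); rewrite divfK ?gt_eqF// /den mulr_sumr.
  apply: eq_bigr => y _; rewrite -mulrBr mulrC.
  have [wx|/(let: And4 _ _ _ h := uP y in h x) ->] := pselect (w y x); last by rewrite !mulr0.
  congr (_ * _); rewrite -intrB; congr (_%:~R).
  have [aw _] := wP y.
  have := cochain_cocycle aw aA aB (ex_intro _ x (conj (conj wx Ax) Bx)).
  by lia.
have fE A x : members (cov a) A -> A x -> cis (phi A x) = cis (phi (w x) x).
  move=> aA Ax; have [aw wx] := wP x.
  have := dphi _ _ _ aA aw Ax wx => /(congr1 cis); rewrite cis_int cisB => h.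
  apply: esym; apply: (mulIf (norm1_neq0 (norm1V (cis_norm (phi A x))))).
  by rewrite h divff// norm1_neq0// cis_norm.
exists (fun x => cis (phi (w x) x)); last first.
  exists phi; split=> [A x _ _|A x aA Ax|A B x *].
  - exact: cphi.
  - exact: fE.
  - exact: dphi.
have cA A : circle_map (fun x => cis (phi A x)) by exact: circle_map_cis.
split; last by move=> x; exact: cis_norm.
split=> x; have [aw wx] := wP x.
  apply: (@continuous_near_eq _ _ _ (fun y => complex.Re (cis (phi (w x) y)))).
    by have := member_nbhs aw wx; apply: filterS => y wy; rewrite (fE (w x)).
  by case: (cA (w x)) => -[+ _] _; exact.
apply: (@continuous_near_eq _ _ _ (fun y => complex.Im (cis (phi (w x) y)))).
  by have := member_nbhs aw wx; apply: filterS => y wy; rewrite (fE (w x)).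
by case: (cA (w x)) => -[_ +] _; exact.
Qed.

End representation.

(** * Circle-valued maps on powers of the solenoid *)

Section circle_split.
Context {R : realType}.

(* The homotopy [u |-> f (H s u)] lifts to [L s], and [L s 1] is nearly an integer
   [k] independent of [s].  Then [L s x - k x + clog (f s / f (H s x))] takes the
   same value at all the logarithms [x] in [0, 1] of [z s] (namely at 0 and 1 if
   [z s = 1]), hence it descends to a continuous logarithm. *)
Lemma circle_split (K : topologicalType) (z f : K -> R[i]) (H : K -> R -> K) :
  compact [set: K] -> circle_map z -> circle_map f ->
  continuous (fun p : K * R => H p.1 p.2) ->
  (forall s (x : R), 0 <= x <= 1 -> cis x = z s -> 0 < complex.Re (f s / f (H s x))) ->
  (forall s, 0 < complex.Re (f (H s 1) / f (H s 0))) ->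
  (forall g : K -> R, continuous g -> (forall s, cis (g s) = 1) ->
     forall s t, g s = g t) ->
  exists (k : int) (r : K -> R), continuous r /\
    forall s, f s = f (H s 0) * z s ^ k * cis (r s).
Proof.
move=> cK cz cf cH fH fH1 conn.
have [[s0 _]|/forallNP K0] := pselect (exists s : K, True); last first.
  by exists 0, (fun=> 0); split => s; have := K0 s.
have ch : circle_map (fun p : K * R => f (H p.1 p.2)) by exact: circle_map_comp cH cf.
have [n hn] := @homotopy_steps R K setT (fun s u => f (H s u)) cK ch.
have [L [cL L0 fL]] := @homotopy_lift R K (fun s u => f (H s u)) n ch (fun k u v => hn k u v I).
have nf s : f s != 0 by rewrite norm1_neq0// circle_map_norm.
have nz s : z s != 0 by rewrite norm1_neq0// circle_map_norm.
have cH' x : continuous (fun s => H s x).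
  apply: (@continuous_composition _ _ _ (fun s => (s, x)) _ _ cH).
  by apply: continuous_pair => s; [exact: cvg_id|exact: cvg_cst].
have cL1 : continuous (fun s => L s 1).
  apply: (@continuous_composition _ _ _ (fun s : K => (s, 1 : R)) _ _ cL).
  by apply: continuous_pair => s; [exact: cvg_id|exact: cvg_cst].
have i0 : 0 <= (0 : R) <= 1 by rewrite lexx ler01.
have i1 : 0 <= (1 : R) <= 1 by rewrite lexx ler01.
have cfH x : circle_map (fun s => f (H s x)) by exact: circle_map_comp (cH' x) cf.
pose g1 s := L s 1 - clog (f (H s 1) / f (H s 0)).
have c10 : circle_map (fun s => f (H s 1) / f (H s 0)) by exact: circle_map_div.
(* [g1] is an integer-valued continuous function, constant by [conn]; its value is the exponent
   [k]. *)
have cg1 : continuous g1.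
  by move=> s; apply: cvgB; [exact: cL1|apply: (clog_continuous c10)].
have g11 s : cis (g1 s) = 1.
  rewrite /g1 cisB clogK//; last exact: circle_map_norm s c10.
  by rewrite (fL s 1 i1) [X in _ / (X / _)]mulrC mulfK// divff// norm1_neq0// cis_norm.
have [k kE] := cis_eq1_int (g11 s0).
have L1 s : L s 1 = k%:~R + clog (f (H s 1) / f (H s 0)).
  by rewrite -kE -(conn _ cg1 g11 s) /g1 subrK.
pose w (p : K * R) := f p.1 / f (H p.1 p.2).
have cw : circle_map w.
  by apply: circle_map_div ch; apply: circle_map_comp cf; exact: continuous_fst.
pose g (p : K * R) := L p.1 p.2 - k%:~R * p.2 + clog (w p).
have cg p : 0 < complex.Re (w p) -> {for p, continuous g}.
  move=> wp; apply: cvgD; last exact: clog_continuous.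
  by apply: cvgB; [exact: cL|apply: cvgM; [exact: cvg_cst|exact: continuous_snd]].
have gE s (x : R) : 0 <= x <= 1 -> cis x = z s ->
    cis (g (s, x)) = f s / f (H s 0) / z s ^ k.
  move=> x01 xz; rewrite /g /= cisD cisB clogK ?fH//; last exact: circle_map_norm (s, x) cw.
  have -> : cis (k%:~R * x) = z s ^ k.
    by rewrite -xz cisXz.
  rewrite /w/= (fL s x x01); have := norm1_neq0 (cis_norm (L s x)).
  have := nf (H s 0); have := @expfz_neq0 _ (z s) k (nz s).
  by move=> h1 h2 h3; field; rewrite h1 h2 h3.
(* Logarithms in [0, 1] of one number are equal or are 0 and 1. In the latter case the two values of
   [g] differ by an integer, and also by a sum of three principal logarithms, so by less than
   3/4. *)
have geq s (x y : R) : 0 <= x <= 1 -> 0 <= y <= 1 -> cis x = z s -> cis y = z s ->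
    g (s, x) = g (s, y).
  move=> x01 y01 xz yz.
  wlog xy : x y x01 y01 xz yz / x < y.
    by move=> W; have [/W->|/W->|->] := ltgtP x y.
  have [/andP[x0 x1] /andP[y0 y1]] := conj x01 y01.
  have [y1'|y1'] := ltP (y - x) 1.
    have /eqP : y - x = 0.
      apply: cis_eq1_lt; first by rewrite cisB xz yz divff.
      by rewrite ger0_norm// subr_ge0 ltW.
    by rewrite subr_eq0 => /eqP yx; move: xy; rewrite yx ltxx.
  have x0' : x = 0 by lra.
  have y1'' : y = 1 by lra.
  move: xz yz; rewrite x0' y1'' => {x01 y01 xy x0 x1 y0 y1 y1'} xz yz.
  apply/eqP; rewrite -subr_eq0; apply/eqP/cis_eq1_lt.
    rewrite cisB !gE// divff// mulf_neq0 ?invr_neq0 ?expfz_neq0//.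
    by rewrite mulf_neq0 ?invr_neq0.
  rewrite /g /= L0 L1 mulr0 mulr1 subr0 add0r.
  have := clog_lt (@circle_map_norm R _ w (s, 0 : R) cw) (fH _ _ i0 xz).
  have := clog_lt (@circle_map_norm R _ w (s, 1 : R) cw) (fH _ _ i1 yz).
  have := clog_lt (circle_map_norm s c10) (fH1 s).
  rewrite !ltr_norml => /andP[? ?] /andP[? ?] /andP[? ?].
  by apply/andP; split; lra.
have [x xP] : {x : K -> R & forall s, 0 <= x s <= 1 /\ cis (x s) = z s}.
  apply: (@choice _ _ (fun s x => 0 <= x <= 1 /\ cis x = z s)) => s.
  by have [t t01 tz] := cis_surj (circle_map_norm s cz); exists t.
exists k, (fun s => g (s, x s)); split; last first.
  move=> s; have [x01 xz] := xP s; rewrite gE// -mulrA [_ * (_ / _)]mulrC divfK ?expfz_neq0//.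
  by rewrite mulrC divfK.
(* The choice [x] need not be continuous. By compactness of [0, 1] it suffices to argue near each
   x': if x' is a logarithm of [z s], then [g] is continuous at (s, x') and its value there is that
   at [x s]; otherwise no point near x' is a logarithm of [z s'] for s' near s. *)
move=> s; apply/cvgrPdist_lt => e e0 /=.
have /compact_near_coveringP := @segment_compact R 0 1.
move=> /(_ K (nbhs s) (fun s' x' => cis x' = z s' ->
  `|g (s, x s) - g (s', x')| < e)) H'.
have {H'} : \forall s' \near s, `[0, 1]%classic `<=` (fun x' => cis x' = z s' ->
  `|g (s, x s) - g (s', x')| < e).
  apply: H' => x' /=; rewrite in_itv /= => x'01.
  have [x'z|x'z] := pselect (cis x' = z s).
    have cg' := cg (s, x') (fH _ _ x'01 x'z).
    have [x01 xz] := xP s; rewrite (geq s _ x')//.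
    have /cvgrPdist_lt /(_ e e0) := cg'.
    rewrite -[X in X -> _]/(\forall p \near nbhs (s, x'), `|g (s, x') - g p| < e).
    case=> -[U V] /= [Us Vx] UV; exists (V, U) => // -[a b] /= [Va Ub] _.
    exact: (UV (b, a)).
  pose v (p : K * R) := cis p.2 / z p.1.
  have cv : circle_map v.
    apply: circle_map_div; first by apply: circle_map_cis; exact: continuous_snd.
    by apply: circle_map_comp cz; exact: continuous_fst.
  have v1 : complex.Re (v (s, x')) < 1.
    rewrite ltNge; apply/negP => /(norm1_Re_ge1 (circle_map_norm _ cv)) h.
    by apply: x'z; rewrite -[LHS](divfK (nz s)) [_ / _]h mul1r.
  have [[cr _] _] := cv.
  have : \forall p \near (s, x'), complex.Re (v p) < 1.
    have /(@open_comp _ _ (fun p => complex.Re (v p)) [set x | x < 1] (fun p _ => cr p)) := @open_lt R 1.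
    by move=> o; apply: (open_nbhs_nbhs (conj o _)).
  case=> -[U V] /= [Us Vx] UV; exists (V, U) => // -[a b] /= [Va Ub] ab.
  have := UV (b, a) (conj Ub Va); rewrite /= /v /= ab divff//.
  by rewrite ltxx.
apply: filterS => s' /(_ (x s')); have [x01 xz] := xP s'.
by apply => //=; rewrite in_itv.
Qed.

End circle_split.

(** * Subspaces, products and the topology of the solenoid *)

Lemma continuous_set_val (T : topologicalType) (A : set T) :
  continuous (set_val : A -> T).
Proof. exact: initial_continuous. Qed.

Lemma continuous_set_type (S T : topologicalType) (A : set T) (f : S -> A) :
  continuous (fun x => set_val (f x)) -> continuous f.
Proof. exact: continuous_comp_initial. Qed.

Lemma compact_set_type (T : topologicalType) (A : set T) :
  compact A -> compact [set: A].
Proof.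
move=> cA F PF _.
have FA : (set_val @ F) A.
  by apply: (@filterS _ F _ setT) => [x _|]; [exact: set_valP|exact: filterT].
have [p [Ap clp]] := cA (set_val @ F) (fmap_proper_filter _ PF) FA.
exists (SigSub (mem_set Ap)); split => // B C FB [_ [[W oW <-] /= Wp WC]].
have [_ [[x Bx <-] Wx]] := clp (set_val @` B) W
  (@filterS _ F _ _ _ (fun x Bx => ex_intro2 _ _ x Bx erefl) FB) (open_nbhs_nbhs (conj oW Wp)).
by exists x; split => //; exact: WC.
Qed.

Lemma injective_hausdorff (S T : topologicalType) (f : S -> T) :
  continuous f -> injective f -> hausdorff_space T -> hausdorff_space S.
Proof.
move=> cf fI hT x y xy; apply: fI; apply: hT => A B fA fB.
have [z [Az Bz]] := xy _ _ (cf x _ fA) (cf y _ fB).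
by exists (f z).
Qed.

Lemma hausdorff_set_type (T : topologicalType) (A : set T) :
  hausdorff_space T -> hausdorff_space A.
Proof.
apply: injective_hausdorff; first exact: continuous_set_val.
by move=> x y; exact: val_inj.
Qed.

Lemma continuous_prod_topology (I : Type) (S : topologicalType)
    (T : I -> topologicalType) (f : S -> prod_topology T) :
  (forall i, continuous (fun x => f x i)) -> continuous f.
Proof.
move=> cf x; apply/cvg_sup => i.
move=> U [_ [[W oW <-] /= Wx WU]].
apply: (filterS (fun y Wy => WU _ Wy)).
by apply: (cf i x); exact: open_nbhs_nbhs.
Qed.

Lemma continuous_coord (I : Type) (T : I -> topologicalType) (i : I) :
  continuous (fun f : prod_topology T => f i).
Proof. exact: (@proj_continuous {classic I} T i). Qed.

Lemma hausdorff_prod_topology (I : Type) (T : I -> topologicalType) :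
  (forall i, hausdorff_space (T i)) -> hausdorff_space (prod_topology T).
Proof. exact: (@hausdorff_product {classic I} T). Qed.

Lemma compact_prod_topology (I : Type) (T : I -> topologicalType) :
  (forall i, compact [set: T i]) -> compact [set: prod_topology T].
Proof.
move=> cT; have := @tychonoff {classic I} T (fun=> setT) cT.
by rewrite (_ : [set f | _] = setT) // -subTset => f _ i.
Qed.

Section complex_topology.
Context {R : realType}.

Lemma continuous_Re : continuous (@complex.Re R : R[i]^o -> R).
Proof.
move=> z; have FF := nbhs_filter (z : R[i]^o).
apply/(@cvgrPdist_lt _ _ _ _ FF) => e e0 /=.
have zU : nbhs (z : R[i]^o) [set w | `|z - w| < (e%:C)%C].
  by exists (e%:C)%C => //=; rewrite ltcR.
apply: (@filterS _ _ FF _ _ _ zU) => w /=; rewrite normc_def ltcR; apply: le_lt_trans.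
by rewrite -raddfB /= -sqrtr_sqr ler_wsqrtr// lerDl sqr_ge0.
Qed.

Lemma continuous_Im : continuous (@complex.Im R : R[i]^o -> R).
Proof.
move=> z; have FF := nbhs_filter (z : R[i]^o).
apply/(@cvgrPdist_lt _ _ _ _ FF) => e e0 /=.
have zU : nbhs (z : R[i]^o) [set w | `|z - w| < (e%:C)%C].
  by exists (e%:C)%C => //=; rewrite ltcR.
apply: (@filterS _ _ FF _ _ _ zU) => w /=; rewrite normc_def ltcR; apply: le_lt_trans.
by rewrite -raddfB /= -sqrtr_sqr ler_wsqrtr// lerDr sqr_ge0.
Qed.

Lemma ccont_continuous (T : topologicalType) (f : T -> R[i]^o) :
  ccont f -> continuous f.
Proof.
move=> [cr ci] x; apply/cvgrPdist_lt => e e0 /=.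
have eE : e = ((complex.Re e)%:C)%C.
  by rewrite RRe_real// gtr0_real.
have e0' : 0 < complex.Re e / 2 by rewrite divr_gt0//; move: e0; rewrite {1}eE ltcR.
have /cvgrPdist_lt /(_ _ e0') := cr x; have /cvgrPdist_lt /(_ _ e0') := ci x.
apply: filterS2 => y hi hr; rewrite eE; set z := f x - f y.
have -> : z = (complex.Re z)%:C%C + 'i%C * (complex.Im z)%:C%C by exact: complexE.
apply: le_lt_trans (ler_normD _ _) _.
rewrite normrM !normc_def /= expr0n /= !addr0 add0r.
rewrite !sqrtr_sqr normr1 mul1r.
rewrite -raddfD /= ltcR [ltRHS]splitr; apply: ltrD.
  by rewrite /z raddfB.
by rewrite /z raddfB.
Qed.

Lemma hausdorff_complex : hausdorff_space (R[i]^o : topologicalType).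
Proof. exact: norm_hausdorff. Qed.

End complex_topology.

Section solenoid.
Context {R : realType} {A : choiceType}.

Definition solenoid_power : topologicalType :=
  prod_topology (fun _ : A => adelic_solenoid R).

Implicit Types (s t : solenoid_power) (a b : A).

Definition scoord s a (n : nat) : R[i] := set_val (set_val (s a) n).

Lemma scoord_norm s a n : `|scoord s a n| = 1.
Proof. exact: (set_valP (set_val (s a) n)). Qed.

Lemma scoordS s a n : scoord s a n.+1 ^+ n.+2 = scoord s a n.
Proof. exact: (set_valP (s a) n). Qed.

Lemma scoord_ext s t : (forall a n, scoord s a n = scoord t a n) -> s = t.
Proof.
move=> st; apply: functional_extensionality_dep => a; apply: val_inj.
by apply: functional_extensionality_dep => n; apply: val_inj; exact: st.
Qed.

Lemma circle_map_scoord a n : circle_map (fun s => scoord s a n).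
Proof.
have c : continuous (fun s => scoord s a n : R[i]^o).
  apply: (@continuous_composition _ _ _ (fun s => set_val (s a) n) set_val);
    last exact: continuous_set_val.
  apply: (@continuous_composition _ _ _ (fun s => set_val (s a))
    (fun u : prod_topology (fun=> @circle R) => u n)); last exact: continuous_coord.
  apply: (@continuous_composition _ _ _ (fun s : solenoid_power => s a) set_val).
    exact: continuous_coord.
  exact: continuous_set_val.
split; last by move=> s; exact: scoord_norm.
split; first exact: (continuous_composition c continuous_Re).
exact: (continuous_composition c continuous_Im).
Qed.

Lemma continuous_solenoid (T : topologicalType) (F : T -> solenoid_power) :
  (forall a n, circle_map (fun x => scoord (F x) a n)) -> continuous F.
Proof.
move=> cF; apply: continuous_prod_topology => a; apply: continuous_set_type.
apply: continuous_prod_topology => n; apply: continuous_set_type.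
by apply: ccont_continuous; case: (cF a n).
Qed.

Lemma solenoid_ex (z : A -> nat -> R[i]) : (forall a n, `|z a n| = 1) ->
  (forall a n, z a n.+1 ^+ n.+2 = z a n) ->
  exists s, forall a n, scoord s a n = z a n.
Proof.
move=> z1 zS.
pose u a n : @circle R := SigSub (mem_set (z1 a n : @circle R (z a n))).
pose P := [set s : prod_topology (fun _ : nat => @circle R) |
    forall n, set_val (s n.+1) ^+ n.+2 = set_val (s n)].
have uP a : P (u a) by move=> n; exact: zS.
by exists (fun a => SigSub (mem_set (uP a))).
Qed.

Lemma compact_circle : compact (@circle R).
Proof.
have -> : @circle R = (fun t : R => cis t : R[i]^o) @` `[0, 1].
  rewrite eqEsubset; split => [z /= z1|_ [t _ <-]]; last exact: cis_norm.
  by have [t t01 tz] := cis_surj z1; exists t => //=; rewrite in_itv.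
apply: continuous_compact; last exact: segment_compact.
apply: continuous_subspaceT; apply: ccont_continuous.
by have [] := @circle_map_cis R _ (id : R -> R) (fun x => @cvg_id _ (nbhs x)).
Qed.

Lemma hausdorff_solenoid_power : hausdorff_space solenoid_power.
Proof.
apply: hausdorff_prod_topology => a; apply: hausdorff_set_type.
apply: hausdorff_prod_topology => n; apply: hausdorff_set_type.
exact: hausdorff_complex.
Qed.

Lemma compact_solenoid_power : compact [set: solenoid_power].
Proof.
apply: compact_prod_topology => a; apply: compact_set_type.
apply: subclosed_compact (subsetT _); last first.
  by apply: compact_prod_topology => n; apply: compact_set_type; exact: compact_circle.
have c n : circle_map (fun s : prod_topology (fun _ : nat => @circle R) =>
    (set_val (s n) : R[i])).
  have c : continuous (fun s : prod_topology (fun _ : nat => @circle R) =>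
      (set_val (s n) : R[i]^o)).
    apply: (@continuous_composition _ _ _ _ set_val); first exact: continuous_coord.
    exact: continuous_set_val.
  split; last by move=> s; exact: (set_valP (s n)).
  split; first exact: (continuous_composition c continuous_Re).
  exact: (continuous_composition c continuous_Im).
(* On the unit circle Re <= 1 with equality only at 1, so each compatibility equation becomes a
   closed real inequality. *)
have -> : [set s : prod_topology (fun _ : nat => @circle R) |
      forall n, set_val (s n.+1) ^+ n.+2 = set_val (s n)] =
    \bigcap_n ((fun s : prod_topology (fun _ : nat => @circle R) =>
      complex.Re (set_val (s n.+1) ^+ n.+2 / set_val (s n))) @^-1` [set x | 1 <= x]).
  rewrite eqEsubset; split => s /= hs n; first move=> _ /=.
    by rewrite hs divff// norm1_neq0//; exact: (set_valP (s n)).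
  have cn := circle_map_div (circle_mapXn n.+2 (c n.+1)) (c n).
  have := norm1_Re_ge1 (circle_map_norm s cn) (hs n I).
  by move=> /(congr1 ( *%R^~ (set_val (s n)))); rewrite mul1r divfK// norm1_neq0//;
    exact: (set_valP (s n)).
apply: closed_bigI => n _.
have [[cr _] _] := circle_map_div (circle_mapXn n.+2 (c n.+1)) (c n).
by apply: closed_comp => [x _|]; [exact: cr|exact: closed_ge].
Qed.

End solenoid.

Section solenoid_characters.
Context {R : realType} {A : choiceType}.
Local Notation G := (@solenoid_power R A).
Implicit Types (s t : G) (a b : A).

Lemma scoord_eq_le s t a m n : (m <= n)%N -> scoord s a n = scoord t a n ->
  scoord s a m = scoord t a m.
Proof.
elim: n => [|n ih]; first by rewrite leqn0 => /eqP ->.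
rewrite leq_eqVlt => /orP[/eqP->//|]; rewrite ltnS => mn st; apply: ih => //.
by rewrite -(scoordS s) -(scoordS t) st.
Qed.

(** By [uniform_control] on pairs of points, closeness of finitely many coordinates suffices. Since
    a lower coordinate is a power of a higher one, equality at one common level n covers them
    all. *)
Lemma solenoid_control (D : G * G -> R) (e : R) : continuous D ->
  (forall s, D (s, s) < e) ->
  exists (J : seq A) (n : nat), forall s t,
    (forall a, a \in J -> scoord s a n = scoord t a n) -> D (s, t) < e.
Proof.
move=> cD De.
pose d (i : A * nat) (p : G * G) : R :=
  1 - complex.Re (scoord p.1 i.1 i.2 / scoord p.2 i.1 i.2).
have cC : circle_map (fun p : G * G => (1 : R[i])) by exact: circle_map_cst (normr1 _).
have cc (i : A * nat) : circle_map (fun p : G * G => scoord p.1 i.1 i.2 / scoord p.2 i.1 i.2).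
  apply: circle_map_div.
    exact: circle_map_comp continuous_fst (circle_map_scoord i.1 i.2).
  exact: circle_map_comp continuous_snd (circle_map_scoord i.1 i.2).
have cd i : continuous (d i).
  have [[cr _] _] := cc i.
  by apply: continuous_subr cr; exact: cst_continuous.
have cG : compact [set: G * G].
  by rewrite -setXTT; apply: compact_setX; exact: compact_solenoid_power.
have [|S [k Sk]] := uniform_control cG cd cD (e := e).
  move=> [s t] _ /= h; suff -> : s = t by exact: De.
  apply: scoord_ext => a n; have := h (a, n); rewrite /d /= subr_le0.
  move=> /(norm1_Re_ge1 (circle_map_norm (s, t) (cc (a, n)))) /= h1.
  by rewrite -[LHS](divfK (norm1_neq0 (scoord_norm t a n))) h1 mul1r.
exists [seq i.1 | i <- S], (\max_(i <- S) i.2)%N => s t st.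
apply: Sk => // -[a n] aS; rewrite /d /=.
rewrite (@scoord_eq_le s t a n (\max_(i <- S) i.2)%N); last first.
  by apply: st; apply/mapP; exists (a, n).
  exact: (@leq_bigmax_seq _ S xpredT (fun x : A * nat => x.2) (a, n) aS isT).
by rewrite divff ?norm1_neq0 ?scoord_norm//= subrr invr_gt0.
Qed.

(* The one-parameter subgroup of the solenoid whose [n]-th coordinate has
   period 1. *)
Definition line (n : nat) (x : R) (m : nat) : R[i] :=
  cis (x * (n.+1`!)%:R / (m.+1`!)%:R).

Lemma line_norm n x m : `|line n x m| = 1.
Proof. exact: cis_norm. Qed.

Lemma lineS n x m : line n x m.+1 ^+ m.+2 = line n x m.
Proof.
rewrite /line -cisMn; congr cis; rewrite -[LHS]mulr_natl (factS m.+1) natrM.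
have m0 : m.+2%:R != 0 :> R by rewrite pnatr_eq0.
have f0 : (m.+1`!)%:R != 0 :> R by rewrite pnatr_eq0 -lt0n fact_gt0.
by move: (m.+2%:R : R) ((m.+1`!)%:R : R) m0 f0 => p q p0 q0; field; rewrite p0 q0.
Qed.

Lemma line_id n x : line n x n = cis x.
Proof. by rewrite /line mulfK// pnatr_eq0 -lt0n fact_gt0. Qed.

Lemma line0 n m : line n 0 m = 1.
Proof. by rewrite /line !mul0r cis0. Qed.

Lemma circle_map_line n m (T : topologicalType) (x : T -> R) :
  continuous x -> circle_map (fun y => line n (x y) m).
Proof.
move=> cx; apply: circle_map_cis => y.
by apply: cvgM; [apply: cvgM; [exact: cx|exact: cvg_cst]|exact: cvg_cst].
Qed.

(** A point need not be joined to the unit element by a path, but its n-th coordinates are those of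
    an endpoint of a one-parameter subgroup. Between the two points g changes by less than 1, hence
    not at all, and along the subgroup it is constant. *)
Lemma solenoid_int_cst (g : G -> R) : continuous g ->
  (forall s, cis (g s) = 1) -> forall s t, g s = g t.
Proof.
move=> cg g1.
have cD : continuous (fun p : G * G => `|g p.1 - g p.2|).
  apply: continuous_normr; apply: continuous_subr.
    exact: (continuous_composition continuous_fst cg).
  exact: (continuous_composition continuous_snd cg).
have [|J [n Jn]] := solenoid_control cD (e := 1).
  by move=> s; rewrite /= subrr normr0.
have [one oneE] : exists one : G, forall a m, scoord one a m = 1.
  by apply: (@solenoid_ex R A (fun _ _ => 1)) => *; rewrite ?normr1 ?expr1n.
suff h s : g s = g one by move=> s t; rewrite !h.
have [x xP] : {x : A -> R & forall a, cis (x a) = scoord s a n}.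
  apply: (@choice _ _ (fun a x => cis x = scoord s a n)) => a.
  by have [t _ tz] := cis_surj (scoord_norm s a n); exists t.
have [rho rhoP] : {rho : R -> G &
    forall u a m, scoord (rho u) a m = line n (u * x a) m}.
  apply: (@choice _ _ (fun u t => forall a m, scoord t a m = line n (u * x a) m)) => u.
  by apply: solenoid_ex => *; [exact: line_norm|exact: lineS].
have crho : continuous rho.
  apply: continuous_solenoid => a m; under eq_fun do rewrite rhoP.
  by apply: circle_map_line => u; apply: cvgM; [exact: cvg_id|exact: cvg_cst].
have -> : g s = g (rho 1).
  apply/eqP; rewrite -subr_eq0; apply/eqP/cis_eq1_lt.
    by rewrite cisB !g1 divr1.
  by apply: (Jn s (rho 1)) => a _; rewrite rhoP mul1r line_id xP.
have -> : one = rho 0.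
  by apply: scoord_ext => a m; rewrite oneE rhoP mul0r line0.
have i0 : `[0, 1]%classic (0 : R) by rewrite /= in_itv /= lexx ler01.
have i1 : `[0, 1]%classic (1 : R) by rewrite /= in_itv /= lexx ler01.
have cgr : continuous (g \o rho) by exact: continuous_composition crho cg.
exact: (connected_int_cst (@segment_connected R 0 1) cgr (fun x _ => g1 _) i1 i0).
Qed.

(* Replacing the coordinates in [J'] by 1 one after the other changes [f] by
   powers of the [n]-th coordinates, up to maps with a logarithm, as soon as [f]
   is nearly determined by the [n]-th coordinates. *)
Lemma solenoid_circle_map (f : G -> R[i]) : circle_map f ->
  exists (n : nat) (J : seq A) (k : A -> int) (r : G -> R),
    [/\ uniq J, continuous r &
        forall s, f s = \prod_(a <- J) scoord s a n ^ k a * cis (r s)].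
Proof.
move=> cf.
have cD : continuous (fun p : G * G => - complex.Re (f p.1 / f p.2)).
  have [[cr _] _] := circle_map_div (circle_map_comp (@continuous_fst G G) cf)
                             (circle_map_comp (@continuous_snd G G) cf).
  exact: continuous_oppr.
have nf s : f s != 0 by rewrite norm1_neq0// circle_map_norm.
have [|J0 [n Jn]] := solenoid_control cD (e := 0).
  by move=> s; rewrite /= divff// oppr_lt0 ltr01.
have {}Jn s t : (forall a, a \in J0 -> scoord s a n = scoord t a n) ->
    0 < complex.Re (f s / f t) by move=> /Jn; rewrite oppr_lt0.
have [reset resetP] : {reset : seq A -> G -> G & forall J s a m,
    scoord (reset J s) a m = if a \in J then 1 else scoord s a m}.
  have ex (J : seq A) s : exists t : G, forall a m,
      scoord t a m = if a \in J then 1 else scoord s a m.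
    apply: (@solenoid_ex R A (fun a m => if a \in J then 1 else scoord s a m)) => a m;
      case: ifP => _; first exact: normr1.
    - exact: scoord_norm.
    - exact: expr1n.
    - exact: scoordS.
  by exists (fun J s => sval (cid (ex J s))) => J s; exact: svalP (cid (ex J s)).
have creset J : continuous (reset J).
  apply: continuous_solenoid => a m.
  rewrite (_ : (fun s => _) = fun s => if a \in J then 1 else scoord s a m);
    last by apply/funext => s; rewrite resetP.
  by case: (a \in J); [exact: circle_map_cst (normr1 _)|exact: circle_map_scoord].
have [k [r [cr fk]]] : exists (k : A -> int) (r : G -> R), continuous r /\
    forall s, f s = f (reset (undup J0) s)
      * \prod_(a <- undup J0) scoord s a n ^ k a * cis (r s).
  elim: (undup J0) (undup_uniq J0) => [_|j J ih /= /andP[jJ uJ]].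
    exists (fun=> 0), (fun=> 0); split=> [|s]; first exact: cst_continuous.
    rewrite big_nil cis0 !mulr1; congr f; apply: scoord_ext => a m.
    by rewrite resetP.
  have [k [r [cr fk]]] := ih uJ.
  (* The homotopy that moves the j-th factor along the line through 1 and keeps the other factors;
     at x = 0 it resets that factor. *)
  have [H HP] : {H : G -> R -> G & forall s x a m, scoord (H s x) a m =
      if a == j then line n x m else scoord s a m}.
    have ex s (x : R) : exists t : G, forall a m,
        scoord t a m = if a == j then line n x m else scoord s a m.
      apply: (@solenoid_ex R A (fun a m => if a == j then line n x m else scoord s a m)) => a m;
        case: ifP => _; first exact: line_norm.
      - exact: scoord_norm.
      - exact: lineS.
      - exact: scoordS.
    by exists (fun s x => sval (cid (ex s x))) => s x; exact: svalP (cid (ex s x)).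
  have cH : continuous (fun p : G * R => H p.1 p.2).
    apply: continuous_solenoid => a m.
    rewrite (_ : (fun p : G * R => _) =
        fun p => if a == j then line n p.2 m else scoord p.1 a m);
      last by apply/funext => p; rewrite HP.
    case: (a == j); first by apply: circle_map_line; exact: continuous_snd.
    exact: circle_map_comp continuous_fst (circle_map_scoord a m).
  (* If x is a logarithm of the n-th coordinate of the j-th factor, [H s x] has the same n-th
     coordinates as s, which is all that [Jn] looks at. *)
  have h1 s (x : R) : 0 <= x <= 1 -> cis x = scoord s j n ->
      0 < complex.Re (f (reset J s) / f (reset J (H s x))).
    move=> _ xs; apply: Jn => a _; rewrite !resetP HP; case: ifP => // _.
    by case: eqP => // ->; rewrite line_id xs.
  have h2 s : 0 < complex.Re (f (reset J (H s 1)) / f (reset J (H s 0))).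
    apply: Jn => a _; rewrite !resetP !HP; case: ifP => // _.
    by case: eqP => // _; rewrite !line_id cis1 cis0.
  have [k' [r' [cr' fk']]] := circle_split compact_solenoid_power
    (circle_map_scoord j n) (circle_map_comp (creset J) cf) cH h1 h2 solenoid_int_cst.
  exists (fun a => if a == j then k' else k a), (fun s => r' s + r s); split.
    exact: continuous_addr.
  move=> s; rewrite fk fk' big_cons eqxx cisD.
  have -> : reset J (H s 0) = reset (j :: J) s.
    apply: scoord_ext => a m; rewrite !resetP HP inE line0.
    by case: eqP => //= _; case: ifP.
  rewrite [in RHS](eq_big_seq (fun a => scoord s a n ^ k a)); last first.
    by move=> a aJ; case: eqP => // aj; move: jJ; rewrite -aj aJ.
  by rewrite -!mulrA; congr (_ * (_ * _)); rewrite mulrCA.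
have [one oneE] : exists one : G, forall a m, scoord one a m = 1.
  by apply: (@solenoid_ex R A (fun _ _ => 1)) => *; rewrite ?normr1 ?expr1n.
have [t0 _ t0E] := cis_surj (circle_map_norm one cf).
(* With all factors in [J0] reset, f is within a quarter turn of its value at the unit, so the
   remaining factor has a principal logarithm. *)
pose w s := f (reset (undup J0) s) / f one.
have cw : circle_map w.
  apply: circle_map_div; first exact: circle_map_comp (creset _) cf.
  exact: circle_map_cst (circle_map_norm one cf).
have w0 s : 0 < complex.Re (w s).
  by apply: Jn => a aJ; rewrite resetP mem_undup aJ oneE.
exists n, (undup J0), k, (fun s => clog (w s) + t0 + r s); split.
- exact: undup_uniq.
- apply: continuous_addr cr; apply: continuous_addr; last exact: cst_continuous.
  by move=> s; exact: clog_continuous.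
- move=> s; rewrite fk !cisD clogK// ?(circle_map_norm s cw)// t0E /w.
  by rewrite divfK//; ring.
Qed.

End solenoid_characters.

(** * Logarithms on simply connected geodesic spaces *)

Section lifting.
Context {R : realType}.

Lemma within_continuous_comp_in (S T U : topologicalType) (A : set T)
    (f : T -> U) (h : S -> T) :
  {within A, continuous f} -> continuous h -> (forall x, A (h x)) ->
  continuous (fun x => f (h x)).
Proof.
move=> /subspace_sigL_continuousP cf ch hA.
pose h' x : A := SigSub (mem_set (hA x)).
have ch' : continuous h' by apply: continuous_set_type.
exact: (continuous_composition ch' cf).
Qed.

Lemma continuous_paste (T : topologicalType) (f g : R -> T) (c : R) :
  continuous f -> continuous g -> f c = g c ->
  continuous (fun t => if t <= c then f t else g t).
Proof.
move=> cf cg fg x; have [xc|xc|xc] := ltgtP x c.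
- apply: (continuous_near_eq (g := f)) (cf x).
  by have := lt_nbhsl xc; apply: filterS => y /ltW ->.
- apply: (continuous_near_eq (g := g)) (cg x).
  by have := lt_nbhsr xc; apply: filterS => y; rewrite leNgt => ->.
- rewrite xc => U /=; rewrite lexx => fU.
  have fU' := cf c _ fU; have gU : nbhs (g c) U by rewrite -fg.
  have gU' := cg c _ gU.
  apply: (@filterS2 _ (nbhs c) _ _ _ _ _ fU' gU') => y /= fy gy.
  by case: (y <= c).
Qed.

Variables (X : topologicalType) (f : X -> R[i]).
Hypothesis cf : circle_map f.

(** A path is lifted as a homotopy that does not depend on its parameter; compactness is then only
    needed over the single parameter 0. *)
Lemma path_lift (c : R -> X) : continuous c ->
  exists2 L : R -> R, continuous L &
    forall t, 0 <= t <= 1 -> f (c t) = cis (L t).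
Proof.
move=> cc; pose h (_ : R) u := f (c u).
have ch : circle_map (fun p : R * R => h p.1 p.2).
  exact: circle_map_comp (continuous_composition continuous_snd cc) cf.
have [n hn] := @homotopy_steps R R [set 0] h (@compact_set1 R 0) ch.
have [L [cL L0 hL]] := @homotopy_lift R R h n ch (fun k u v => hn 0 u v erefl).
have [t0 _ t0E] := cis_surj (circle_map_norm (c 0) cf).
exists (fun t => t0 + L 0 t) => [|t t01].
  apply: continuous_addr; first exact: cst_continuous.
  apply: (@continuous_composition _ _ _ (fun t : R => (0 : R, t)) _ _ cL).
  by apply: continuous_pair => u; [exact: cvg_cst|exact: cvg_id].
by rewrite cisD t0E -(hL 0 t t01).
Qed.

Lemma lift_increment (L M : R -> R) : continuous L -> continuous M ->
  (forall t, 0 <= t <= 1 -> cis (L t) = cis (M t)) ->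
  L 1 - L 0 = M 1 - M 0.
Proof.
move=> cL cM LM.
have c : continuous (fun t => L t - M t) by exact: continuous_subr.
have i0 : `[0, 1]%classic (0 : R) by rewrite /= in_itv /= lexx ler01.
have i1 : `[0, 1]%classic (1 : R) by rewrite /= in_itv /= lexx ler01.
have := connected_int_cst (@segment_connected R 0 1) c.
move=> /(_ _ 1 0 i1 i0) h; suff : L 1 - M 1 = L 0 - M 0 by lra.
apply: h => t /=; rewrite in_itv /= => t01.
by rewrite cisB LM// divff// norm1_neq0// cis_norm.
Qed.

(** Lift the homotopy in its second variable from 0. The increment [M s 1] vanishes at s = 0 and s =
    1, where the homotopy is constant, while [L s + M s 1] is a logarithm of the constant top edge
    and hence constant. *)
Lemma nullhomotopic_lift (x : X) (c : R -> X) (L : R -> R) :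
  nullhomotopic_loop x c -> continuous L ->
  (forall t, 0 <= t <= 1 -> f (c t) = cis (L t)) -> L 1 = L 0.
Proof.
move=> [H [cH H0 H1 Hx]] cL Lc.
have cH' : continuous (fun p : R * R => H (clamp p.1, clamp p.2)).
  apply: (@within_continuous_comp_in _ _ _ _ H (fun p : R * R => (clamp p.1, clamp p.2)) cH).
    apply: continuous_pair.
      exact: continuous_composition continuous_fst clamp_continuous.
    exact: continuous_composition continuous_snd clamp_continuous.
  by move=> p; split; rewrite /= in_itv /=; exact: clamp_itv.
pose h s t := f (H (clamp s, clamp t)).
have ch : circle_map (fun p : R * R => h p.1 p.2) by exact: circle_map_comp cH' cf.
have [n hn] := @homotopy_steps R R `[0, 1] h (@segment_compact R 0 1) ch.
have hn' k u v : 0 <= u <= 1 -> 0 <= v <= 1 ->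
    `|u - v| <= n.+1%:R^-1 -> 0 < complex.Re (h k u / h k v).
  have := hn (clamp k) u v; rewrite /h (clamp_id (clamp_itv k)); apply.
  by rewrite /= in_itv /= clamp_itv.
have [M [cM M0 hM]] := @homotopy_lift R R h n ch hn'.
have i0 : 0 <= (0 : R) <= 1 by rewrite lexx ler01.
have i1 : 0 <= (1 : R) <= 1 by rewrite lexx ler01.
have hx (s t : R) : 0 <= t <= 1 -> (s = 0 \/ s = 1) -> h s t = f x.
  move=> t01 s01; have s01' : 0 <= s <= 1 by case: s01 => ->.
  rewrite /h !clamp_id//; congr f.
  have [] := Hx t; first by rewrite in_itv.
  by case: s01 => ->.
have cMs (s : R) : continuous (M s).
  apply: (@continuous_composition _ _ _ (fun t : R => (s, t)) _ _ cM).
  by apply: continuous_pair => u; [exact: cvg_cst|exact: cvg_id].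
have cMt (t : R) : continuous (fun s => M s t).
  apply: (@continuous_composition _ _ _ (fun s : R => (s, t)) _ _ cM).
  by apply: continuous_pair => u; [exact: cvg_id|exact: cvg_cst].
have M1 (s : R) : (s = 0 \/ s = 1) -> M s 1 = 0.
  move=> s01; have := @lift_increment (M s) (fun=> 0) (cMs s) (@cst_continuous _ _ _).
  rewrite M0 !subr0; apply => t t01; rewrite cis0.
  have := hM s t t01; rewrite !hx// -{1}[f x]mulr1 => /mulfI ->//.
  by rewrite norm1_neq0// circle_map_norm.
have cLM : continuous (fun s => L s + M s 1) by exact: continuous_addr.
have := @lift_increment _ (fun=> L 0) cLM (@cst_continuous _ _ _).
rewrite !M1; [|by left|by right]; rewrite !addr0 subrr => h0.
apply/eqP; rewrite -subr_eq0 h0// => s s01.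
rewrite cisD -Lc//.
have hs0 (s' : R) : 0 <= s' <= 1 -> h s' 0 = f (c s').
  move=> ?; rewrite /h !clamp_id// H0// in_itv/=.
rewrite -Lc// -!hs0// -hM//.
rewrite (hx 0 0)//; last by left.
by rewrite /h !clamp_id// H1// in_itv/=.
Qed.

Hypothesis Xsc : simply_connected R X.

Lemma triangle_lift (x y z : X) (a b g : R -> X) (La Lb Lg : R -> R) :
  continuous a -> continuous b -> continuous g ->
  a 0 = x -> a 1 = y -> g 0 = y -> g 1 = z -> b 0 = x -> b 1 = z ->
  continuous La -> continuous Lb -> continuous Lg ->
  (forall t, 0 <= t <= 1 -> f (a t) = cis (La t)) ->
  (forall t, 0 <= t <= 1 -> f (b t) = cis (Lb t)) ->
  (forall t, 0 <= t <= 1 -> f (g t) = cis (Lg t)) ->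
  (La 1 - La 0) + (Lg 1 - Lg 0) = Lb 1 - Lb 0.
Proof.
move=> ca cb cg a0 a1 g0 g1 b0 b1 cLa cLb cLg fa fb fg.
have affine (p q : R) : continuous (fun t : R => p * t + q).
  apply: continuous_addr; last exact: cst_continuous.
  by move=> t; apply: cvgM; [exact: cvg_cst|exact: cvg_id].
(* The loop runs through [a], [g] and the reverse of [b], one third of the unit interval each. *)
pose c1 t := a (3 * t + 0).
pose c2 t := g (3 * t - 1).
pose c3 t := b (- 3 * t + 3).
pose c t := if t <= 3^-1 then c1 t else if t <= 2 / 3 then c2 t else c3 t.
have cc : continuous c.
  apply: continuous_paste; first exact: continuous_composition (affine _ _) ca.
    apply: continuous_paste.
    - exact: continuous_composition (affine _ _) cg.
    - exact: continuous_composition (affine _ _) cb.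
    - rewrite /c2 /c3.
      have -> : 3 * (2 / 3) - 1 = 1 :> R by lra.
      have -> : - 3 * (2 / 3) + 3 = 1 :> R by lra.
      by rewrite g1 b1.
  have -> : 3^-1 <= 2 / 3 :> R by lra.
  rewrite /c1 /c2.
  have -> : 3 * 3^-1 + 0 = 1 :> R by lra.
  have -> : 3 * 3^-1 - 1 = 0 :> R by lra.
  by rewrite a1 g0.
have c_0 : c 0 = x.
  by rewrite /c invr_ge0 ler0n /c1 mulr0 addr0 a0.
have c_1 : c 1 = x.
  rewrite /c; have -> : (1 <= 3^-1 :> R) = false by apply/negbTE; rewrite -ltNge; lra.
  have -> : (1 <= 2 / 3 :> R) = false by apply/negbTE; rewrite -ltNge; lra.
  by rewrite /c3 (_ : _ + 3 = 0) ?b0//; lra.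
have [L cL Lc] := path_lift cc.
have L10 : L 1 = L 0.
  have pb : path_between c x x.
    by split; [exact: (continuous_subspaceT cc)|exact: c_0|exact: c_1].
  exact: (nullhomotopic_lift (Xsc.2 x c pb) cL Lc).
have sub (p q : R) (d : R -> X) (Ld : R -> R) : continuous Ld ->
    (forall t, 0 <= t <= 1 -> f (d t) = cis (Ld t)) ->
    (forall t, 0 <= t <= 1 -> 0 <= p * t + q <= 1 /\ c (p * t + q) = d t) ->
    L (p * 1 + q) - L (p * 0 + q) = Ld 1 - Ld 0.
  move=> cLd fd cd.
  have cLpq : continuous (fun t => L (p * t + q)) by exact: continuous_composition (affine p q) cL.
  apply: (lift_increment cLpq cLd) => t t01; have [pq cpq] := cd t t01.
  by rewrite -Lc// cpq fd.
have h1 : L (3^-1 * 1 + 0) - L (3^-1 * 0 + 0) = La 1 - La 0.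
  apply: (sub _ _ a) => // t /andP[t0 t1]; split; first by lra.
  rewrite /c ifT; last by lra.
  by rewrite /c1; congr a; lra.
have h2 : L (3^-1 * 1 + 3^-1) - L (3^-1 * 0 + 3^-1) = Lg 1 - Lg 0.
  apply: (sub _ _ g) => // t /andP[t0 t1]; split; first by lra.
  rewrite /c; case: ifP => [ht|_].
    have -> : t = 0 by lra.
    by rewrite /c1 g0 (_ : _ + 0 = 1) ?a1//; lra.
  rewrite ifT; last by lra.
  by rewrite /c2; congr g; lra.
have h3 : L (- 3^-1 * 1 + 1) - L (- 3^-1 * 0 + 1) = Lb 1 - Lb 0.
  apply: (sub _ _ b) => // t /andP[t0 t1]; split; first by lra.
  rewrite /c ifF; last by apply/negbTE; rewrite -ltNge; lra.
  case: ifP => [ht|_].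
    have -> : t = 1 by lra.
    by rewrite /c2 b1 (_ : _ - 1 = 1) ?g1//; lra.
  by rewrite /c3; congr b; lra.
rewrite -h1 -h2 -h3.
have -> : 3^-1 * 0 + 0 = 0 :> R by lra.
have -> : 3^-1 * 1 + 0 = 3^-1 :> R by lra.
have -> : 3^-1 * 0 + 3^-1 = 3^-1 :> R by lra.
have -> : - 3^-1 * 0 + 1 = 1 :> R by lra.
have -> : - 3^-1 * 1 + 1 = 3^-1 * 1 + 3^-1 :> R by lra.
by rewrite L10; lra.
Qed.

End lifting.

Section geodesic_lift.
Context {R : realType} {X : metricType R}.

Lemma near_mdistP (x : X) (P : X -> Prop) :
  (\forall y \near x, P y) <->
  exists2 d : R, 0 < d & forall y, mdist x y < d -> P y.
Proof.
exact: (metricType_numDomainType.nbhs_mdistP x P).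
Qed.

Lemma continuous_mdist (x : X) : continuous (fun y => mdist x y : R).
Proof.
move=> y; apply/cvgrPdist_lt => e e0; apply/near_mdistP; exists e => // z yz.
rewrite /= ltr_distlC; have h1 := metric_triangle x y z.
have h2 := metric_triangle x z y; rewrite (metric_sym z y) in h2.
by apply/andP; split; lra.
Qed.

Hypothesis Xgeo : geodesic_metric X.

(** The last clause is the point: a geodesic does not leave the closed ball around x through y, so a
    bound on f over that ball holds along the path. *)
Lemma geodesic_path (x y : X) : exists g : R -> X,
  [/\ continuous g, g 0 = x, g 1 = y & forall t, mdist x (g t) <= mdist x y].
Proof.
have [xi [iso xi0 xi1]] := Xgeo x y.
have d0 : 0 <= mdist x y := mdist_ge0 x y.
pose u (t : R) := clamp t * mdist x y.
have u01 t : u t \in `[0, mdist x y].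
  have /andP[c0 c1] := clamp_itv t.
  by rewrite in_itv /= mulr_ge0//= ler_piMl.
have cu : continuous u.
  by apply: continuous_mulr; [exact: clamp_continuous|exact: cst_continuous].
have z01 : 0 \in `[0, mdist x y] by rewrite in_itv /= lexx.
exists (fun t => xi (u t)); split.
- move=> t; apply/cvg_ballP => e e0.
  have /cvgrPdist_lt /(_ e e0) := cu t; apply: filterS => s.
  by rewrite ballEmdist /= iso.
- by rewrite /u clamp_id ?lexx ?ler01// mul0r.
- by rewrite /u clamp_id ?lexx ?ler01// mul1r.
- move=> t; have := u01 t; rewrite in_itv /= => /andP[t0 t1].
  by rewrite -{1}xi0 iso// sub0r normrN ger0_norm.
Qed.

(* On a set where [f] stays within a quarter turn of [f x], the increments of a
   logarithm along a geodesic from [x] are given by the principal logarithm. *)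
Lemma geodesic_log (f : X -> R[i]) (x y : X) : circle_map f ->
  (forall z, mdist x z <= mdist x y -> 0 < complex.Re (f z / f x)) ->
  exists g L : R -> _, [/\ continuous g, g 0 = x, g 1 = y, continuous L &
    (forall t, f (g t) = f x * cis (L t)) /\
    L 0 = 0 /\ L 1 = clog (f y / f x)].
Proof.
move=> cf fx; have [g [cg g0 g1 gd]] := geodesic_path x y.
have cfg : circle_map (fun t => f (g t) / f x).
  apply: circle_map_div; first exact: circle_map_comp cg cf.
  by apply: circle_map_cst; exact: circle_map_norm.
have nx : f x != 0 by rewrite norm1_neq0// circle_map_norm.
exists g, (fun t => clog (f (g t) / f x)); split => //.
  by move=> t; apply: clog_continuous => //; apply: fx.
split; last by rewrite g0 g1 divff// clog1.
move=> t; rewrite clogK ?(circle_map_norm t cfg) ?fx//.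
by rewrite mulrC divfK.
Qed.

(** Integrate along any path from a base point; [triangle_lift] makes the result independent of the
    path up to short geodesics, along which the increment is a principal logarithm. This yields
    continuity. *)
Lemma circle_map_log (f : X -> R[i]) : simply_connected R X -> circle_map f ->
  exists2 h : X -> R, continuous h & forall x, f x = cis (h x).
Proof.
move=> Xsc cf.
have [[b _]|/forallNP X0] := pselect (exists b : X, True); last first.
  by exists (fun=> 0) => x; have := X0 x.
have [g gP] : {g : X -> R -> X & forall x, [/\ continuous (g x), g x 0 = b & g x 1 = x]}.
  apply: (@choice _ _ (fun x (g : R -> X) => [/\ continuous g, g 0 = b & g 1 = x])) => x.
  have [g [cg g0 g1]] := Xsc.1 b x; exists (fun t => g (clamp t)); split.
  - apply: (within_continuous_comp_in cg); first exact: clamp_continuous.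
    by move=> t; rewrite /= in_itv /=; exact: clamp_itv.
  - by rewrite clamp_id ?lexx ?ler01.
  - by rewrite clamp_id ?lexx ?ler01.
have [L LP] : {L : X -> R -> R & forall x, continuous (L x) /\
    forall t : R, 0 <= t <= 1 -> f (g x t) = cis (L x t)}.
  apply: (@choice _ _ (fun x (L : R -> R) => continuous L /\
    forall t : R, 0 <= t <= 1 -> f (g x t) = cis (L t))) => x.
  by have [cg _ _] := gP x; have [L cL Lg] := path_lift cf cg; exists L.
have [t0 _ t0E] := cis_surj (circle_map_norm b cf).
have i0 : 0 <= (0 : R) <= 1 by rewrite lexx ler01.
have i1 : 0 <= (1 : R) <= 1 by rewrite lexx ler01.
pose h x := t0 + (L x 1 - L x 0).
have hE x : f x = cis (h x).
  have [_ g0 g1] := gP x; have [_ Lg] := LP x.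
  rewrite /h cisD cisB t0E -!Lg// g0 g1 mulrC divfK// norm1_neq0//.
  exact: circle_map_norm.
exists h => // x; apply/cvgrPdist_lt => e e0.
have cr : circle_map (fun y => f y / f x).
  apply: circle_map_div => //; apply: circle_map_cst; exact: circle_map_norm.
have nx : f x != 0 by rewrite norm1_neq0// circle_map_norm.
have /near_mdistP [d1 d10 d1P] : \forall y \near x, 0 < complex.Re (f y / f x).
  have [[cre _] _] := cr.
  have := @open_comp _ _ (fun y => complex.Re (f y / f x)) [set t | 0 < t]
    (fun y _ => cre y) (@open_gt R 0).
  by move=> o; apply: (open_nbhs_nbhs (conj o _)); rewrite /= divff// ltr01.
have := @clog_continuous R X (fun y => f y / f x) x cr.
rewrite divff//= => /(_ ltr01)/cvgrPdist_lt/(_ e e0)/near_mdistP[d2 d20 d2P].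
apply/near_mdistP; exists (Num.min d1 d2); first by rewrite lt_min d10.
move=> y; rewrite lt_min => /andP[y1 y2].
have [|gy [Ly [cgy gy0 gy1 cLy [fLy [Ly0 Ly1]]]]] := @geodesic_log f x y cf.
  by move=> z zy; apply: d1P; exact: le_lt_trans zy y1.
have [[cgx gx0 gx1] [cLx LxP]] := (gP x, LP x).
have [[cgy' gy0' gy1'] [cLy' LyP]] := (gP y, LP y).
have cLy2 : continuous (fun t => h x + Ly t).
  by apply: continuous_addr cLy; exact: cst_continuous.
have fgy (t : R) : 0 <= t <= 1 -> f (gy t) = cis (h x + Ly t).
  by rewrite cisD -hE fLy.
have tri := triangle_lift cf Xsc cgx cgy' cgy gx0 gx1 gy0 gy1 gy0' gy1'
  cLx cLy' cLy2 LxP LyP fgy.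
have -> : h x - h y = clog (f x / f x) - clog (f y / f x).
  by rewrite divff// clog1 -Ly1 /h -tri Ly0; lra.
exact: d2P.
Qed.

Definition slow (f : X -> R) (x0 : X) : Prop :=
  forall r e : R, 0 < r -> 0 < e -> exists M : R, forall x y : X,
    M < mdist x x0 -> mdist x y < r -> `|f x - f y| < e.

(** Small oscillation of [cis (f x)] alone would allow f to jump by integers; following the geodesic
    from x to y, along which the quotient stays in the right half plane, shows that the increment of
    f is the principal one. *)
Lemma slow_log (x0 : X) (f : X -> R) : continuous f ->
  (forall r e : R, 0 < r -> 0 < e -> exists M : R, forall x y : X,
    M < mdist x x0 -> mdist x y < r ->
    0 < complex.Re (cis (f y) / cis (f x)) /\
    `|complex.Im (cis (f y) / cis (f x))| < e) ->
  slow f x0.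
Proof.
move=> cf fso r e r0 e0.
have [d d0 dP] : exists2 d : R, 0 < d & forall v : R, `|v| < d -> `|asin v / (2 * pi)| < e.
  have p0 : 0 < 2 * pi :> R by rewrite mulr_gt0// pi_gt0.
  have := @continuous_asin R 0; rewrite ltrN10 ltr01 => /(_ isT).
  have as0 : asin (0 : R) = 0.
    by rewrite -{1}(sin0 R) sinK// in_itv /= oppr_le0 !divr_ge0 ?pi_ge0.
  move=> /cvgrPdist_lt /(_ (e * (2 * pi)) (mulr_gt0 e0 p0)).
  rewrite -nbhs_ballE => -[d d0 dP]; exists d => // v vd.
  rewrite normrM normfV (gtr0_norm p0) ltr_pdivrMr//.
  by have := dP v; rewrite /ball /= as0 !sub0r !normrN; apply.
have [M MP] := fso r d r0 d0; exists M => x y xM xy.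
have cc : circle_map (fun x => cis (f x)) by exact: circle_map_cis.
have [|g [L [cg g0 g1 cL [fL [L0 L1]]]]] := @geodesic_log _ x y cc.
  by move=> z zy; have [] := MP x z xM (le_lt_trans zy xy).
have [_ imy] := MP x y xM xy.
have : f y - f x = L 1 - L 0.
  have cL' : continuous (fun t => f x + L t).
    by apply: continuous_addr cL; exact: cst_continuous.
  have := lift_increment (continuous_composition cg cf) cL'.
  rewrite g0 g1 => ->; first by lra.
  by move=> t _; rewrite fL cisD.
rewrite L0 L1 subr0 distrC => ->.
exact: dP.
Qed.

End geodesic_lift.

(** * Slowly oscillating functions and the Higson compactification *)

Section slowly_oscillating.
Context {R : realType} {X : metricType R} (x0 : X).
Implicit Types f g : X -> R.

Lemma slowly_oscillatingP f : slowly_oscillating (Y := R^o) x0 f <-> slow f x0.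
Proof.
split=> fso.
  move=> r e r0 e0; have [M MP] := fso r r0 e e0; exists M => x y xM xy.
  rewrite -lte_fin; apply: le_lt_trans (MP x xM); apply: ereal_sup_ubound.
  exists (f y), (f x); split => //; first by exists y => //; rewrite ballEmdist.
  by exists x => //; rewrite ballEmdist /= mdistxx.
(* Comparing two points of the ball through its centre doubles e/4, and the supremum must still be
   strictly below e. *)
move=> r r0 e e0; have e4 : 0 < e / 4 by rewrite divr_gt0.
have [M MP] := fso r _ r0 e4; exists M => x xM.
apply: (@le_lt_trans _ _ (e / 2)%:E); last by rewrite lte_fin; lra.
apply: ge_ereal_sup => _ [_ [_ [[y xy <-] [z xz <-] ->]]].
rewrite lee_fin /mdist /=; move: xy xz; rewrite !ballEmdist /= => xy xz.
have hy := MP _ _ xM xy; have hz := MP _ _ xM xz.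
have -> : f z - f y = (f x - f y) - (f x - f z) by lra.
by apply: le_trans (ler_normB _ _) _; lra.
Qed.

Lemma bounded_funP f : bounded_fun (f : X -> R^o) <-> exists M, forall x, `|f x| <= M.
Proof.
split=> [[M [_ MP]]|[M MP]].
  by exists (M + 1) => x; apply: MP => //; rewrite ltrDl.
exists M; split; first exact: num_real.
by move=> N MN x _ /=; apply: le_trans (MP x) (ltW MN).
Qed.

Lemma slow_cst (c : R) : slow (fun _ : X => c) x0.
Proof. by move=> r e _ e0; exists 0 => x y _ _; rewrite subrr normr0. Qed.

Lemma slow_add f g : slow f x0 -> slow g x0 -> slow (fun x => f x + g x) x0.
Proof.
move=> fso gso r e r0 e0; have e2 : 0 < e / 2 by rewrite divr_gt0.
have [M MP] := fso r _ r0 e2; have [N NP] := gso r _ r0 e2.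
exists (Num.max M N) => x y; rewrite gt_max => /andP[Mx Nx] xy.
have := MP _ _ Mx xy; have := NP _ _ Nx xy.
have -> : f x + g x - (f y + g y) = (f x - f y) + (g x - g y) by lra.
by move=> *; apply: le_lt_trans (ler_normD _ _) _; lra.
Qed.

Lemma slow_comp f (h : R -> R) : slow f x0 ->
  (forall e, 0 < e -> exists2 d, 0 < d & forall s t, `|s - t| < d -> `|h s - h t| < e) ->
  slow (fun x => h (f x)) x0.
Proof.
move=> fso hu r e r0 e0; have [d d0 dP] := hu e e0.
have [M MP] := fso r d r0 d0; exists M => x y xM xy.
by apply: dP; exact: MP.
Qed.

Lemma slow_lipschitz f (h : R -> R) (k : R) : slow f x0 ->
  (forall s t, `|h s - h t| <= k * `|s - t|) -> slow (fun x => h (f x)) x0.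
Proof.
move=> fso hk; apply: slow_comp fso _ => e e0.
have k1 : 0 < `|k| + 1 by rewrite ltr_wpDl.
exists (e / (`|k| + 1)) => [|s t]; first by rewrite divr_gt0.
rewrite ltr_pdivlMr// => st; apply: le_lt_trans (hk s t) _.
apply: le_lt_trans st; rewrite mulrC ler_wpM2l//.
by have := ler_norm k; lra.
Qed.

Lemma slow_scale f (c : R) : slow f x0 -> slow (fun x => c * f x) x0.
Proof.
move=> fso; apply: (@slow_lipschitz f (fun t => c * t) `|c| fso) => s t.
by rewrite -mulrBr normrM.
Qed.

Lemma slow_sum (I : Type) (s : seq I) (h : I -> X -> R) :
  (forall i, slow (h i) x0) -> slow (fun x => \sum_(i <- s) h i x) x0.
Proof.
move=> hso; elim: s => [|i s ih].
  by under eq_fun do rewrite big_nil; exact: slow_cst.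
by under eq_fun do rewrite big_cons; exact: slow_add.
Qed.

(** The addition formulas reduce a uniform modulus to continuity at 0. *)
Lemma trig_modulus (c : R) (e : R) : 0 < e -> exists2 d : R, 0 < d &
  forall s t : R, `|s - t| < d ->
    `|cos (c * s) - cos (c * t)| < e /\ `|sin (c * s) - sin (c * t)| < e.
Proof.
move=> e0; have e2 : 0 < e / 2 by rewrite divr_gt0.
have cl : continuous (fun t : R => c * t).
  by apply: continuous_mulr; [exact: cst_continuous|move=> x; exact: cvg_id].
have cc : continuous (fun t : R => cos (c * t)).
  exact: continuous_composition cl (@continuous_cos R).
have cs : continuous (fun t : R => sin (c * t)).
  exact: continuous_composition cl (@continuous_sin R).
have /cvgrPdist_lt /(_ _ e2) h1 := cc 0.
have /cvgrPdist_lt /(_ _ e2) h2 := cs 0.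
have := filterI h1 h2; rewrite -nbhs_ballE => -[d d0 dP].
exists d => // s t st; have := dP (s - t).
rewrite /ball /= mulr0 cos0 sin0 !sub0r !normrN => /(_ st) [h3 h4].
have sE : c * s = c * t + c * (s - t) by lra.
have cle := cos_max (c * t); have sle := sin_max (c * t).
split.
  rewrite sE cosD.
  have -> : cos (c * t) * cos (c * (s - t)) - sin (c * t) * sin (c * (s - t)) - cos (c * t)
    = - (cos (c * t) * (1 - cos (c * (s - t)))) - sin (c * t) * sin (c * (s - t)) by ring.
  apply: le_lt_trans (ler_normB _ _) _; rewrite normrN !normrM [ltRHS]splitr.
  by apply: ltrD; apply: le_lt_trans (ler_piMl _ _) _.
rewrite sE sinD.
have -> : sin (c * t) * cos (c * (s - t)) + cos (c * t) * sin (c * (s - t)) - sin (c * t)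
    = - (sin (c * t) * (1 - cos (c * (s - t)))) + cos (c * t) * sin (c * (s - t)) by ring.
apply: le_lt_trans (ler_normD _ _) _; rewrite normrN !normrM [ltRHS]splitr.
by apply: ltrD; apply: le_lt_trans (ler_piMl _ _) _.
Qed.

Lemma higsonP f : higson_functions x0 f <->
  [/\ exists M, forall x, `|f x| <= M, continuous f & slow f x0].
Proof.
split; first by move=> [/bounded_funP ? ? /slowly_oscillatingP ?].
by move=> [? ? ?]; split => //; [exact/bounded_funP|exact/slowly_oscillatingP].
Qed.

Lemma higson_Re_cis f : continuous f -> slow f x0 ->
  higson_functions x0 (fun x => complex.Re (cis (f x))).
Proof.
move=> cf fso; apply/higsonP; split.
- by exists 1 => x; exact: cos_max.
- by case: (circle_map_cis cf) => -[].
- apply: (@slow_comp f (fun t => complex.Re (cis t))) => // e /(trig_modulus (2 * pi)) [d d0 dP].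
  by exists d => // s t /dP [].
Qed.

Lemma higson_Im_cis f : continuous f -> slow f x0 ->
  higson_functions x0 (fun x => complex.Im (cis (f x))).
Proof.
move=> cf fso; apply/higsonP; split.
- by exists 1 => x; exact: sin_max.
- by case: (circle_map_cis cf) => -[].
- apply: (@slow_comp f (fun t => complex.Im (cis t))) => // e /(trig_modulus (2 * pi)) [d d0 dP].
  by exists d => // s t /dP [].
Qed.

End slowly_oscillating.

Section higson.
Context {R : realType} {X : metricType R} (x0 : X).
Local Notation H := (higson_functions x0).
Local Notation Xbar := (higson_compactification x0).

Lemma hembed_mem (x : X) :
  closure (range (@higson_embed R X x0)) (higson_embed x).
Proof. by apply: subset_closure; exists x. Qed.

Definition hembed (x : X) : Xbar := SigSub (mem_set (@hembed_mem x)).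

Definition hcoord (g : H) (p : Xbar) : R := set_val (set_val p g).

Lemma hcoordE (g : H) x : hcoord g (hembed x) = set_val g x.
Proof. by []. Qed.

Lemma hcoord_continuous (g : H) : continuous (hcoord g).
Proof.
apply: (@continuous_composition _ _ _ (fun p : Xbar => set_val p g) set_val);
  last exact: continuous_set_val.
apply: (@continuous_composition _ _ _ (set_val : Xbar -> _)
  (fun u : higson_cube x0 => u g)); last exact: continuous_coord.
exact: continuous_set_val.
Qed.

Lemma hcoord_ext (p q : Xbar) : (forall g, hcoord g p = hcoord g q) -> p = q.
Proof.
move=> pq; apply: val_inj; apply: functional_extensionality_dep => g.
by apply: val_inj; exact: pq.
Qed.

Lemma compact_higson : compact [set: Xbar].
Proof.
apply: compact_set_type; apply: subclosed_compact (subsetT _).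
  exact: closed_closure.
apply: compact_prod_topology => g; apply: compact_set_type.
exact: segment_compact.
Qed.

Lemma hausdorff_higson : hausdorff_space Xbar.
Proof.
apply: hausdorff_set_type; apply: hausdorff_prod_topology => g.
apply: hausdorff_set_type; exact: norm_hausdorff.
Qed.

Lemma hembed_continuous : continuous hembed.
Proof.
apply: continuous_set_type; apply: continuous_prod_topology => g.
by apply: continuous_set_type; have [] := set_valP g.
Qed.

Lemma hembed_dense (C : set Xbar) : closed C -> (forall x, C (hembed x)) ->
  forall p, C p.
Proof.
move=> cC hC p; apply: contrapT => nCp.
have [W oW WC] : open (~` C) by exact: closed_openC.
have Wp : W (set_val p) by rewrite -[W _]/((set_val @^-1` W) p) WC.
have [_ [[x _ <-] Wx]] := set_valP p W (open_nbhs_nbhs (conj oW Wp)).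
have : (set_val @^-1` W) (hembed x) by [].
by rewrite WC; apply; exact: hC.
Qed.

Lemma hembed_eq (f g : Xbar -> R) : continuous f -> continuous g ->
  (forall x, f (hembed x) = g (hembed x)) -> forall p, f p = g p.
Proof.
move=> cf cg fg p; apply/eqP; rewrite -subr_eq0; apply/eqP.
apply: (@hembed_dense [set p | f p - g p = 0]); last first.
  by move=> x /=; rewrite fg subrr.
apply: (@closed_comp _ _ (fun p => f p - g p) [set 0]).
  by move=> x _; exact: (continuous_subr cf cg).
exact: closed_eq.
Qed.

Lemma ccont_hembed_eq (f g : Xbar -> R[i]) : ccont f -> ccont g ->
  (forall x, f (hembed x) = g (hembed x)) -> forall p, f p = g p.
Proof.
move=> [rf imf] [rg img] fg p; apply/eqP; rewrite eq_complex.
by apply/andP; split; apply/eqP;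
  [apply: (hembed_eq rf rg)|apply: (hembed_eq imf img)] => x; rewrite fg.
Qed.

(* A continuous function on the compactification depends, up to any prescribed
   error, on finitely many coordinates, each of them slowly oscillating. *)
Lemma higson_oscillation (D : Xbar * Xbar -> R) (r e : R) :
  continuous D -> (forall p, D (p, p) < e) -> 0 < r ->
  exists M : R, forall x y : X, M < mdist x x0 -> mdist x y < r ->
    D (hembed x, hembed y) < e.
Proof.
move=> cD De r0.
have cK : compact [set: Xbar * Xbar].
  by rewrite -setXTT; apply: compact_setX; exact: compact_higson.
pose d (g : H) (p : Xbar * Xbar) := `|hcoord g p.1 - hcoord g p.2|.
have cd g : continuous (d g).
  apply: continuous_normr; apply: continuous_subr.
    exact: continuous_composition continuous_fst (@hcoord_continuous g).
  exact: continuous_composition continuous_snd (@hcoord_continuous g).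
have [|s [n sn]] := uniform_control cK cd cD (e := e).
  move=> [p q] _ /= h; suff -> : p = q by exact: De.
  apply: hcoord_ext => g; apply/eqP; rewrite -subr_eq0 -normr_eq0 eq_le normr_ge0 andbT.
  exact: h.
have [M MP] : exists M : R, forall x y : X, M < mdist x x0 -> mdist x y < r ->
    forall g, g \in s -> `|set_val g x - set_val g y| < n.+1%:R^-1.
  elim: s {sn} => [|g s [M MP]]; first by exists 0.
  have /higsonP [_ _ gso] := set_valP g.
  have n0 : 0 < n.+1%:R^-1 :> R by rewrite invr_gt0 ltr0n.
  have [N NP] := gso r _ r0 n0; exists (Num.max M N) => x y.
  rewrite gt_max => /andP[xM xN] xy g'; rewrite inE => /orP[/eqP ->|].
    exact: NP.
  exact: MP.
by exists M => x y xM xy; apply: sn => // g gs; exact: MP.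
Qed.

(** The quotient [f p.2 / f p.1] is 1 on the diagonal, so [higson_oscillation] bounds its real and
    imaginary parts as [slow_log] requires. *)
Lemma higson_circle_slow (f : Xbar -> R[i]) (h : X -> R) : geodesic_metric X ->
  circle_map f -> continuous h -> (forall x, f (hembed x) = cis (h x)) ->
  slow h x0.
Proof.
move=> Xgeo cf ch fh; apply: (slow_log Xgeo) => // r e r0 e0.
have [[cr ci] _] : circle_map (fun p : Xbar * Xbar => f p.2 / f p.1).
  apply: circle_map_div; first exact: circle_map_comp continuous_snd cf.
  exact: circle_map_comp continuous_fst cf.
have nf p : f p != 0 by rewrite norm1_neq0// circle_map_norm.
have [|M MP] := higson_oscillation (continuous_oppr cr) (e := 0) _ r0.
  by move=> p /=; rewrite divff//= oppr_lt0 ltr01.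
have [|N NP] := higson_oscillation (continuous_normr ci) (e := e) _ r0.
  by move=> p /=; rewrite divff//= normr0.
exists (Num.max M N) => x y; rewrite gt_max => /andP[xM xN] xy.
rewrite -!fh; split; last exact: (NP x y).
by rewrite -oppr_lt0; exact: (MP x y).
Qed.

(** Even for unbounded h, the cosine and sine are bounded and slowly oscillating, so each is a
    coordinate of the compactification. *)
Lemma higson_extend_cis (h : X -> R) : continuous h -> slow h x0 ->
  exists2 f : Xbar -> R[i], circle_map f & forall x, f (hembed x) = cis (h x).
Proof.
move=> ch hso.
pose gr : H := SigSub (mem_set (higson_Re_cis ch hso)).
pose gi : H := SigSub (mem_set (higson_Im_cis ch hso)).
exists (fun p => (hcoord gr p +i* hcoord gi p)%C); last first.
  by move=> x; rewrite !hcoordE.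
split; first by split; exact: hcoord_continuous.
move=> p; apply/norm1P => /=.
have c2 g : continuous (fun p => hcoord g p ^+ 2).
  have c := @hcoord_continuous g.
  by under eq_fun do rewrite expr2; exact: continuous_mulr.
have c1 : continuous (fun _ : Xbar => 1 : R) by exact: cst_continuous.
apply: (hembed_eq (continuous_addr (c2 gr) (c2 gi)) c1) => x.
by rewrite !hcoordE /= cos2Dsin2.
Qed.

Lemma higson_extend_real (h : X -> R) : (exists M, forall x, `|h x| <= M) ->
  continuous h -> slow h x0 ->
  exists2 f : Xbar -> R, continuous f & forall x, f (hembed x) = h x.
Proof.
move=> hb ch hso.
have hH : H h by apply/higsonP.
exists (hcoord (SigSub (mem_set hH))); first exact: hcoord_continuous.
by move=> x; rewrite hcoordE.
Qed.

Lemma higson_bounded (f : Xbar -> R) : continuous f ->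
  exists M, forall p, `|f p| <= M.
Proof.
move=> cf; have cK : compact [set: Xbar] := compact_higson.
have := continuous_compact (continuous_subspaceT cf) cK.
move=> /compact_bounded [M [_ MP]]; exists (M + 1) => p.
by apply: (MP (M + 1)); rewrite ?ltrDl//; exists p.
Qed.

End higson.

(** * A basis of slowly oscillating functions modulo bounded ones *)

Section codes.
Context {R : realType} {X : metricType R} (x0 : X).
Hypotheses (Xproper : proper_metric X) (Xgeo : geodesic_metric X)
  (Xnc : ~ compact [set: X]).

Lemma compact_disk (M : R) : compact [set x : X | mdist x x0 <= M].
Proof.
have [_ h] := Xproper x0.
have := h _ (@segment_compact R 0 M).
by rewrite (_ : _ @^-1` _ = [set x : X | mdist x x0 <= M])//;
  apply/seteqP; split => x /=; rewrite in_itv /= mdist_ge0.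
Qed.

Lemma mdist_unbounded (M : R) : exists x : X, M < mdist x x0.
Proof.
apply: contrapT => /forallNP h; apply: Xnc.
rewrite (_ : setT = [set x : X | mdist x x0 <= M]); first exact: compact_disk.
by rewrite eqEsubset; split => // x _; rewrite /= leNgt; exact/negP/h.
Qed.

(** A geodesic from [x0] to a point beyond distance d takes the distance d on its way. *)
Lemma mdist_onto (d : R) : 0 <= d -> exists x : X, mdist x x0 = d.
Proof.
move=> d0; have [y dy] := mdist_unbounded d.
have [xi [iso xi0 _]] := Xgeo x0 y.
exists (xi d); rewrite -[in LHS]xi0 iso ?subr0 ?ger0_norm//.
  by rewrite in_itv /= d0 metric_sym ltW.
by rewrite in_itv /= lexx mdist_ge0.
Qed.

Lemma proper_dense_seq : exists pt : nat -> X,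
  forall (x : X) (e : R), 0 < e -> exists n, mdist (pt n) x < e.
Proof.
have net (p : nat * nat) : {s : seq X | forall x, mdist x x0 <= p.1%:R ->
    exists2 z, z \in s & mdist z x < p.2.+1%:R^-1}.
  apply: cid; case: p => n m /=.
  have m0 : 0 < m.+1%:R^-1 :> R by rewrite invr_gt0 ltr0n.
  have o z : setT z -> open [set x : X | mdist z x < m.+1%:R^-1].
    move=> _; exact: (@open_comp _ _ (mdist z) [set t : R | t < m.+1%:R^-1]
      (fun x _ => @continuous_mdist R X z x) (@open_lt R _)).
  have [|E _ EP] := compact_finite_cover (@compact_disk n%:R) o.
    by move=> x _; exists x => //=; rewrite mdistxx.
  by exists (enum_fset E) => x /EP [z zE zx]; exists z.
pose pt k : X := if choice.unpickle k is Some (n, m, i) then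
  nth x0 (sval (net (n, m))) i else x0.
exists pt => x e e0.
have [n nP] : exists n : nat, mdist x x0 <= n%:R.
  by exists (Num.truncn (mdist x x0)).+1; rewrite ltW// truncnS_gt.
have [m /= mP] := filter_ex (near_infty_natSinv_lt (PosNum e0)).
have [z zs zx] := svalP (net (n, m)) x nP.
exists (choice.pickle (n, m, index z (sval (net (n, m))))).
by rewrite /pt choice.pickleK nth_index//; exact: lt_trans mP.
Qed.

Lemma continuous_code : exists e : (X -> R) -> nat -> bool,
  forall f g, continuous f -> continuous g -> e f =1 e g -> f = g.
Proof.
have [pt ptP] := proper_dense_seq.
(* The bits of f are the answers to the questions whether q < f(pt n), for q rational and [pt]
   dense. *)
exists (fun f k => if choice.unpickle k is Some (n, q) then
  (ratr (q : rat) < f (pt n)) else false) => f g cf cg efg.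
have le (h h' : X -> R) : continuous h -> continuous h' ->
    (forall n (q : rat), (ratr q < h (pt n)) = (ratr q < h' (pt n))) ->
    forall x, h x <= h' x.
  move=> ch ch' hh' x; rewrite leNgt; apply/negP => lt.
  have cd : continuous (fun x => h x - h' x) by exact: continuous_subr.
  have : \forall y \near x, 0 < h y - h' y.
    have := @open_comp _ _ (fun y => h y - h' y) [set t | 0 < t]
      (fun y _ => cd y) (@open_gt R 0).
    by move=> o; apply: (open_nbhs_nbhs (conj o _)); rewrite /= subr_gt0.
  move=> /near_mdistP [d d0 dP]; have [n nx] := ptP x d d0.
  have := dP (pt n); rewrite metric_sym => /(_ nx); rewrite subr_gt0.
  move=> /rat_in_itvoo [q]; rewrite in_itv /= => /andP[q1 q2].
  have := hh' n q; rewrite q2 => /esym q3.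
  by move: (lt_trans q1 q3); rewrite ltxx.
have fgE n (q : rat) : (ratr q < f (pt n)) = (ratr q < g (pt n)).
  by have := efg (choice.pickle (n, q)); rewrite choice.pickleK.
apply/funext => x; apply/eqP; rewrite eq_le; apply/andP; split.
  by apply: le.
by apply: le => // n q; rewrite fgE.
Qed.

End codes.

(** * Bumps along almost disjoint sets of integers *)

Section bumps.
Context {R : realType}.

Definition word (i : nat) (c : nat -> bool) (k : nat) : nat :=
  choice.pickle (i, mkseq c k).

Lemma word_inj i c k i' c' k' : word i c k = word i' c' k' ->
  [/\ i = i', k = k' & forall j, (j < k)%N -> c j = c' j].
Proof.
move=> /(pcan_inj choice.pickleK) [ii' /[dup] + mm].
move=> /(congr1 size); rewrite !size_mkseq => kk'; split => // j jk.
by have := congr1 (fun s => nth false s j) mm; rewrite !nth_mkseq// -kk'.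
Qed.

Lemma word_unbounded i c (k M : nat) : exists2 j, (k <= j)%N & (M < word i c j)%N.
Proof.
apply: contrapT => h.
have sub : {subset [seq word i c (k + j) | j <- iota 0 M.+2] <= iota 0 M.+1}.
  move=> _ /mapP[j _ ->]; rewrite mem_iota add0n /= ltnS leqNgt.
  by apply/negP => lt; apply: h; exists (k + j)%N => //; exact: leq_addr.
have un : uniq [seq word i c (k + j) | j <- iota 0 M.+2].
  rewrite map_inj_uniq ?iota_uniq// => a b /word_inj [_ + _].
  by move/addnI.
by have := uniq_leq_size un sub; rewrite size_map !size_iota ltnn.
Qed.

(* The numbers outside the intervals of radius [n] around [4 ^ n], for [n] a
   code of a prefix of [c]; these intervals are disjoint. *)
Definition off_bumps (i : nat) (c : nat -> bool) : set R :=
  [set z | forall k, (word i c k)%:R <= `|z - 4 ^+ word i c k|].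

(** The distance to [off_bumps]: a 1-Lipschitz function with a tent of height n over 4^n for each
    code n. *)
Definition bump (i : nat) (c : nat -> bool) (s : R) : R :=
  inf [set `|s - z| | z in off_bumps i c].

(** Intervals of radii n and m around 4^n and 4^m do not overlap. Powers of 2 would be too dense: 4
    - 2 < 1 + 2. *)
Lemma pow4_sep n m : (n < m)%N -> (n + m + 4 ^ n <= 4 ^ m)%N.
Proof.
elim: m => // m ih; rewrite ltnS leq_eqVlt expnS => /orP[/eqP ->|nm].
  have := @ltn_expl 4 m isT; move: (4 ^ m)%N => p; lia.
have := ih nm; have : (0 < 4 ^ m)%N by rewrite expn_gt0.
move: (4 ^ m)%N => p; lia.
Qed.

Lemma pow4_far (n m : nat) : n != m -> n%:R + m%:R <= `|4 ^+ n - 4 ^+ m| :> R.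
Proof.
wlog nm : n m / (n < m)%N.
  move=> W; rewrite neq_ltn => /orP[h|h]; first by apply: W => //; rewrite neq_ltn h.
  by rewrite distrC addrC; apply: W => //; rewrite neq_ltn h.
move=> _; have := pow4_sep nm; rewrite -(ler_nat R) !natrD !natrX => h.
by rewrite distrC; apply: le_trans (ler_norm _); lra.
Qed.

(** A point outside all the intervals, so that the infimum in [bump] is over a nonempty set. *)
Lemma off_bumps_N1 i c : off_bumps i c (-1).
Proof.
move=> k; rewrite distrC opprK ger0_norm; last first.
  by rewrite addr_ge0// exprn_ge0.
have := @ltn_expl 4 (word i c k) isT.
by rewrite -(ltr_nat R) natrX => h; apply: le_trans (ltW h) _; rewrite lerDl.
Qed.

Lemma bump_has_lbound i c s : has_lbound [set `|s - z| | z in off_bumps i c].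
Proof. by exists 0 => _ [z _ <-]. Qed.

Lemma bump_nonempty i c s : nonempty [set `|s - z| | z in off_bumps i c].
Proof. by exists `|s - (-1)|, (-1) => //; exact: off_bumps_N1. Qed.

Lemma bump_le i c s z : off_bumps i c z -> bump i c s <= `|s - z|.
Proof. by move=> cz; apply: ge_inf; [exact: bump_has_lbound|exists z]. Qed.

Lemma bump_ge0 i c s : 0 <= bump i c s.
Proof. by apply: lb_le_inf; [exact: bump_nonempty|move=> _ [z _ <-]]. Qed.

Lemma bump_eq0 i c s : off_bumps i c s -> bump i c s = 0.
Proof.
move=> cs; apply/eqP; rewrite eq_le bump_ge0 andbT.
by have := bump_le s cs; rewrite subrr normr0.
Qed.

Lemma bump_center i c k : (word i c k)%:R <= bump i c (4 ^+ word i c k).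
Proof.
apply: lb_le_inf; first exact: bump_nonempty.
by move=> _ [z cz <-]; rewrite distrC; exact: cz.
Qed.

Lemma bump_lipschitz i c s t : `|bump i c s - bump i c t| <= `|s - t|.
Proof.
have le u v : bump i c u <= `|u - v| + bump i c v.
  rewrite -lerBlDl; apply: lb_le_inf; first exact: bump_nonempty.
  move=> _ [z cz <-]; rewrite lerBlDl; apply: le_trans (bump_le _ cz) _.
  by apply: le_trans (ler_normD _ _); rewrite addrA subrK.
rewrite ler_norml; have := le s t; have := le t s; rewrite (distrC t).
by move=> h1 h2; apply/andP; split; lra.
Qed.

Lemma bump_disjoint i j c s : i != j -> bump i c s * bump j c s = 0.
Proof.
move=> ij; apply/eqP; rewrite mulf_eq0; apply/negPn; rewrite negb_or.
apply/negP => /andP[bi bj].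
have off l : bump l c s != 0 -> exists k, `|s - 4 ^+ word l c k| < (word l c k)%:R.
  move=> bl; apply: contrapT => /forallNP h; move/negP: bl; apply.
  by apply/eqP/bump_eq0 => k; rewrite leNgt; exact/negP/h.
have [[k kP] [k' k'P]] := (off i bi, off j bj).
have ne : word i c k != word j c k'.
  by apply/eqP => /word_inj [/eqP]; rewrite (negbTE ij).
have := pow4_far ne.
have := ler_distD s (4 ^+ word i c k : R) (4 ^+ word j c k').
rewrite (distrC _ s); lra.
Qed.

Lemma off_bumps_center i c n : (forall k, word i c k != n) ->
  off_bumps i c (4 ^+ n).
Proof.
move=> h k; rewrite distrC; apply: le_trans (pow4_far (h k)).
by rewrite lerDl.
Qed.

End bumps.

Section radial.
Context {R : realType} {X : metricType R} (x0 : X).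

Definition radial_bump (i : nat) (c : nat -> bool) (x : X) : R :=
  bump i c (ln (1 + mdist x x0)).

Lemma slow_ln_mdist : slow (fun x : X => ln (1 + mdist x x0)) x0.
Proof.
have lnle (a b r : R) : 0 <= a -> 0 <= b -> `|a - b| < r ->
    ln (1 + b) - ln (1 + a) <= r / (1 + a).
  move=> a0 b0; rewrite ltr_norml => /andP[h1 h2].
  have p1 : 0 < 1 + a by lra.
  have p2 : 0 < 1 + b by lra.
  rewrite -ln_div ?posrE//.
  have -> : (1 + b) / (1 + a) = 1 + (b - a) / (1 + a) by field; lra.
  apply: le_trans (le_ln1Dx _) _; first by rewrite ltr_pdivlMr//; lra.
  by rewrite ler_pdivrMr// divfK ?gt_eqF//; lra.
(* Beyond r + r/e, both x and y are farther than r/e from [x0], where a step shorter than r changes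
   the logarithm by less than e. *)
move=> r e r0 e0; exists (r + r / e) => x y xM xy.
have d0 := mdist_ge0 x x0; have d1 := mdist_ge0 y x0.
have re0 : 0 < r / e by rewrite divr_gt0.
have xy' : `|mdist x x0 - mdist y x0| < r.
  have h1 := metric_triangle x y x0; have h2 := metric_triangle y x x0.
  by rewrite (metric_sym y x) in h2; rewrite ltr_norml; apply/andP; split; lra.
have yM : r / e < mdist y x0 by move: xy'; rewrite ltr_norml => /andP[? ?]; lra.
have small (a : R) : r / e < a -> r / (1 + a) < e.
  move=> ra; rewrite ltr_pdivrMr; last by lra.
  by move: ra; rewrite ltr_pdivrMr// => ra; lra.
rewrite ltr_norml; apply/andP; split.
  have := lnle _ _ _ d0 d1 xy'.
  have := small (mdist x x0); have xM' : r / e < mdist x x0 by lra.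
  by move=> /(_ xM') ? ?; lra.
rewrite distrC in xy'.
have := lnle _ _ _ d1 d0 xy'.
by have := small _ yM => ? ?; lra.
Qed.

Lemma continuous_ln_mdist : continuous (fun x : X => ln (1 + mdist x x0)).
Proof.
move=> x; apply: (@continuous_comp _ _ _ (fun x => 1 + mdist x x0) (@ln R)).
  apply: continuous_addr; first exact: cst_continuous.
  rewrite (_ : (fun x => _) = mdist x0); first exact: continuous_mdist.
  by apply/funext => y; rewrite metric_sym.
by apply: continuous_ln; rewrite ltr_pwDl// mdist_ge0.
Qed.

Lemma slow_radial_bump i c : slow (radial_bump i c) x0.
Proof.
apply: (@slow_lipschitz _ _ _ _ (bump i c) 1 slow_ln_mdist) => s t.
by rewrite mul1r; exact: bump_lipschitz.
Qed.

Lemma continuous_radial_bump i c : continuous (radial_bump i c).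
Proof.
apply: (continuous_composition continuous_ln_mdist) => s.
apply/cvgrPdist_lt => e e0.
have /cvgrPdist_lt /(_ e e0) := @cvg_id _ (nbhs s); apply: filterS => t.
exact: le_lt_trans (bump_lipschitz _ _ _ _).
Qed.

End radial.

Section independence.
Context {R : realType} {X : metricType R} (x0 : X).
Implicit Types (f g : X -> R) (B C : set (X -> R)) (s : seq (X -> R)).

Definition bounded_fct f : Prop := exists M, forall x, `|f x| <= M.

Lemma bounded_fctZ (c : R) f : bounded_fct f -> bounded_fct (fun x => c * f x).
Proof.
by move=> [M MP]; exists (`|c| * M) => x; rewrite normrM ler_wpM2l.
Qed.

Definition combination (k : (X -> R) -> int) s : X -> R :=
  fun x => \sum_(f <- s) (k f)%:~R * f x.

(** Independence over the rationals modulo bounded functions, with denominators cleared. *)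
Definition independent B : Prop := forall s (k : (X -> R) -> int),
  uniq s -> (forall f, f \in s -> B f) -> bounded_fct (combination k s) ->
  forall f, f \in s -> k f = 0.

Definition slow_continuous : set (X -> R) := [set f | continuous f /\ slow f x0].

Lemma maximal_independent B0 : B0 `<=` slow_continuous -> independent B0 ->
  exists B, [/\ B0 `<=` B, B `<=` slow_continuous, independent B &
    forall f, slow_continuous f -> exists (d : nat) s k,
      [/\ uniq s, forall g, g \in s -> B g &
        bounded_fct (fun x => d.+1%:R * f x - combination k s x)]].
Proof.
move=> B0L B0i.
(* Zorn's lemma is applied to the part added to [B0], because the empty chain has empty union and
   this must satisfy [P]. *)
pose P C := C `<=` slow_continuous /\ independent (C `|` B0).
have [F FP tF|C [[CL Ci] Cmax]] := @Zorn_bigcup (X -> R) P.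
  split=> [f [C FC Cf]|s k us sB ks]; first by have [CL _] := FP C FC; exact: CL.
  have [[C [FC sC]]|sB0] : (exists C, F C /\ forall f, f \in s -> (C `|` B0) f)
      \/ (forall f, f \in s -> B0 f).
    elim: s sB {us ks} => [|g s ih] sB; first by right.
    have {}ih := ih (fun f fs => sB f (mem_behead (s := g :: s) fs)).
    have [[C FC Cg]|B0g] := sB g (mem_head _ _).
      left; case: ih => [[D [FD sD]]|sB0].
        have [CD|DC] := tF _ _ FC FD.
          exists D; split => // f; rewrite inE => /orP[/eqP ->|/sD//].
          by left; exact: CD.
        exists C; split => // f; rewrite inE => /orP[/eqP ->|/sD [Df|]]; first by left.
          by left; exact: DC.
        by right.
      exists C; split => // f; rewrite inE => /orP[/eqP ->|/sB0]; [by left|by right].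
    case: ih => [[D [FD sD]]|sB0]; [left|right].
      by exists D; split => // f; rewrite inE => /orP[/eqP ->|/sD//]; right.
    by move=> f; rewrite inE => /orP[/eqP ->|/sB0].
  - by have [_ Ci] := FP C FC; exact: Ci us sC ks.
  - exact: B0i us sB0 ks.
exists (C `|` B0); split => //.
  by move=> f [/CL|/B0L].
move=> f Lf; have [Bf|nBf] := pselect ((C `|` B0) f).
  exists 0%N, [:: f], (fun=> 1); split => //.
    by move=> g; rewrite inE => /eqP ->.
  by exists 0 => x; rewrite /combination big_seq1 subrr normr0.
have nP : ~ P (C `|` [set f]).
  apply: Cmax; split; last by move=> /(_ f (or_intror erefl)) Cf; apply: nBf; left.
  by move=> g Cg; left.
have ni : ~ independent (C `|` [set f] `|` B0).
  by move=> i; apply: nP; split => // g [/CL|->].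
have [s [k [us sB ks [h hs kh]]]] : exists s k, [/\ uniq s,
    forall g, g \in s -> (C `|` [set f] `|` B0) g,
    bounded_fct (combination k s) & exists2 h, h \in s & k h != 0].
  apply: contrapT => no; apply: ni => s k us sB ks h hs; apply/eqP.
  by apply: contrapT => /negP kh; apply: no; exists s, k; split => //; exists h.
have sub g : g \in s -> g != f -> (C `|` B0) g.
  by move=> /sB [[Cg|->]|B0g] gf; [left| |right] => //; move: gf; rewrite eqxx.
have fs : f \in s.
  apply: contrapT => /negP fs; move/eqP: kh; apply; apply: (Ci s k us _ ks h hs).
  by move=> g gs; apply: sub => //; apply/eqP => gf; move: fs; rewrite -gf gs.
have remE x : combination k s x = (k f)%:~R * f x + combination k (rem f s) x.
  by rewrite /combination (big_rem f fs).
have urem : uniq (rem f s) by exact: rem_uniq.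
have remB g : g \in rem f s -> (C `|` B0) g.
  by rewrite mem_rem_uniq// !inE => /andP[gf gs]; exact: sub.
have kf : k f != 0.
  apply/eqP => kf; move: kh; have [->|hf] := eqVneq h f; first by rewrite kf eqxx.
  rewrite (Ci (rem f s) k urem remB) ?eqxx//.
    have [M MP] := ks; exists M => x; have := MP x.
    by rewrite remE kf mul0r add0r.
  by rewrite mem_rem_uniq// !inE hf.
(* As [k f] is plus or minus d.+1, solving the relation for f negates the other coefficients exactly
   when [k f] is positive. *)
move: kf; case kfE: (k f) => [[|d]|d] // _.
  exists d, (rem f s), (fun g => - k g); split => //.
  have [M MP] := ks; exists M => x; have := MP x; rewrite remE kfE.
  congr (`|_| <= _); congr (_ + _); rewrite /combination -sumrN.
  by apply: eq_bigr => g _; rewrite mulrNz mulNr opprK.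
exists d, (rem f s), k; split => //.
have [M MP] := ks; exists M => x; have := MP x; rewrite remE kfE NegzE mulrNz -normrN.
by congr (`|_| <= _); rewrite -pmulrn; ring.
Qed.

End independence.

Section bump_family.
Context {R : realType} {X : metricType R} (x0 : X).
Hypotheses (Xproper : proper_metric X) (Xgeo : geodesic_metric X)
  (Xnc : ~ compact [set: X]).
Variable e : (X -> R) -> nat -> bool.
Hypothesis eI : forall f g : X -> R,
  continuous f -> continuous g -> e f =1 e g -> f = g.

Definition coded (g : X -> R) (i : nat) : X -> R :=
  fun x => radial_bump x0 i (e g) x + g x.

Definition coded_family : set (X -> R) :=
  [set f | exists g i, [/\ higson_functions x0 g,
    forall x, 0 <= g x <= 1 / 2 & f = coded g i]].

Lemma coded_family_slow : coded_family `<=` slow_continuous x0.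
Proof.
move=> _ [g [i [/higsonP [_ cg gso] _ ->]]]; split.
  by apply: continuous_addr cg; exact: continuous_radial_bump.
by apply: slow_add gso; exact: slow_radial_bump.
Qed.

(** Either the indices differ, or the codes differ at some bit; prefixes beyond that bit then never
    have the same code. *)
Lemma coded_separate (g g' : X -> R) (i i' : nat) :
  higson_functions x0 g -> higson_functions x0 g' ->
  coded g i != coded g' i' ->
  exists j0, forall j k, (j0 <= j)%N -> word i (e g) j != word i' (e g') k.
Proof.
move=> /higsonP [_ cg _] /higsonP [_ cg' _] ne.
have [ii|ii] := eqVneq i i'; last first.
  by exists 0%N => j k _; apply/eqP => /word_inj [/eqP]; rewrite (negbTE ii).
have [j0 j0P] : exists j, e g j != e g' j.
  apply: contrapT => /forallNP h; move/eqP: ne; apply.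
  have -> : g = g' by apply: eI => // j; apply/eqP; rewrite -[_ == _]negbK; exact/negP/h.
  by rewrite ii.
exists j0.+1 => j k jj; apply/eqP => /word_inj [_ _ /(_ j0 jj) h].
by move: j0P; rewrite h eqxx.
Qed.

(* Along the centers of the bumps of [f0] all the other bumps eventually vanish. *)
Lemma coded_family_independent : independent coded_family.
Proof.
move=> s k us sB [M MP] f0 f0s.
have [D DP] : {D : (X -> R) -> (X -> R) * nat & forall f, f \in s ->
    [/\ higson_functions x0 (D f).1, forall x, 0 <= (D f).1 x <= 1 / 2 &
        f = coded (D f).1 (D f).2]}.
  apply: (@choice _ _ (fun f (D : (X -> R) * nat) => f \in s ->
    [/\ higson_functions x0 D.1, forall x, 0 <= D.1 x <= 1 / 2 &
        f = coded D.1 D.2])) => f.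
  have [/sB [g [i h]]|nfs] := boolP (f \in s); first by exists (g, i).
  by exists (f, 0%N).
have [H0 _ f0E] := DP _ f0s.
have [j0 j0P] : exists j0, forall f, f \in s -> f != f0 -> forall j l, (j0 <= j)%N ->
    word (D f0).2 (e (D f0).1) j != word (D f).2 (e (D f).1) l.
  have : {subset s <= s} by [].
  elim: {-2}s => [|f t ih] ts; first by exists 0%N.
  have [j1 j1P] := ih (fun g gt => ts g (mem_behead (s := f :: t) gt)).
  have [ff0|ff0] := eqVneq f f0.
    exists j1 => g; rewrite inE => /orP[/eqP ->|]; last exact: j1P.
    by rewrite ff0 eqxx.
  have [Hf _ fE] := DP _ (ts f (mem_head _ _)).
  have [|j2 j2P] := @coded_separate (D f0).1 (D f).1 (D f0).2 (D f).2 H0 Hf.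
    by rewrite -f0E -fE eq_sym.
  exists (maxn j1 j2) => g; rewrite inE => /orP[/eqP ->|gt] gf0 j l.
    by rewrite geq_max => /andP[_ /j2P]; exact.
  by rewrite geq_max => /andP[h _]; exact: j1P.
pose K : R := \sum_(f <- s) `|(k f)%:~R|.
have MK0 : 0 <= M + K.
  by rewrite addr_ge0//; [exact: le_trans (MP x0)|apply: sumr_ge0].
(* A late prefix whose code n exceeds M + K. At the centre 4^n only the bump of [f0] survives, with
   value at least n, and the bounded summands contribute at most K. *)
have [j jj jN] := word_unbounded (D f0).2 (e (D f0).1) j0 (Num.truncn (M + K)).
set n := word _ _ j in jN.
have nMK : M + K < n%:R.
  by apply: lt_le_trans (truncnS_gt _) _; rewrite ler_nat.
have [x xE] : exists x : X, ln (1 + mdist x x0) = 4 ^+ n.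
  have [|x xE] := @mdist_onto R X x0 Xproper Xgeo Xnc (expR (4 ^+ n) - 1).
    by rewrite subr_ge0 -expR0 ler_expR exprn_ge0.
  by exists x; rewrite xE addrC subrK expRK.
apply/eqP; apply: contrapT => /negP kf0.
have k1 : 1 <= `|(k f0)%:~R| :> R.
  by rewrite -intr_norm -[1]/(1%:~R) ler_int; move: kf0; case: (k f0) => [[|?]|?].
have := MP x; have -> : combination k s x =
    (k f0)%:~R * bump (D f0).2 (e (D f0).1) (4 ^+ n : R)
    + \sum_(f <- s) (k f)%:~R * (D f).1 x.
  have -> : (k f0)%:~R * bump (D f0).2 (e (D f0).1) (4 ^+ n : R) =
      \sum_(f <- s) (k f)%:~R * bump (D f).2 (e (D f).1) (4 ^+ n : R).
    rewrite (big_rem f0 f0s) /= big_seq big1 ?addr0// => f.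
    rewrite mem_rem_uniq// !inE => /andP[ff0 fs].
    rewrite bump_eq0 ?mulr0//; apply: off_bumps_center => l.
    by rewrite eq_sym; exact: j0P.
  rewrite /combination -big_split /= big_seq [RHS]big_seq; apply: eq_bigr => f fs.
  have [_ _ fE] := DP _ fs; rewrite -mulrDr; congr (_ * _).
  by rewrite [LHS](congr1 (fun h => h x) fE) /coded /radial_bump xE.
have gK : `|\sum_(f <- s) (k f)%:~R * (D f).1 x| <= K.
  apply: le_trans (ler_norm_sum _ _ _) _; rewrite /K big_seq [leRHS]big_seq.
  apply: ler_sum => f fs; rewrite normrM ler_piMr//.
  have [_ /(_ x) /andP[g0 g1] _] := DP _ fs.
  by rewrite ger0_norm//; lra.
have bn : n%:R <= `|(k f0)%:~R * bump (D f0).2 (e (D f0).1) (4 ^+ n : R)|.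
  have b := @bump_center R (D f0).2 (e (D f0).1) j.
  rewrite normrM [X in _ * X]ger0_norm ?bump_ge0//.
  by apply: le_trans b _; rewrite ler_peMl// bump_ge0.
move=> hM; have := ler_normB ((k f0)%:~R * bump (D f0).2 (e (D f0).1) (4 ^+ n : R)
  + \sum_(f <- s) (k f)%:~R * (D f).1 x) (\sum_(f <- s) (k f)%:~R * (D f).1 x).
by rewrite addrK; lra.
Qed.

End bump_family.

(** * The embedding *)

Section solenoid_extension.
Context {R : realType} {X : metricType R} (x0 : X) {A : choiceType}.
Variable fa : A -> X -> R.
Hypothesis cfa : forall a, continuous (fa a).
Hypothesis sfa : forall a, slow (fa a) x0.
Local Notation Xbar := (higson_compactification x0).
Local Notation G := (@solenoid_power R A).

(** The level n carries the factor 1/(n+1)!, so that its (n+2)-nd multiple at level n+1 is the value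
    at level n; the relations extend from X by density. *)
Lemma solenoid_extension : exists2 F : Xbar -> G, continuous F &
  forall a n x, scoord (F (hembed x0 x)) a n = cis ((n.+1`!)%:R^-1 * fa a x).
Proof.
have [E EP] : {E : A * nat -> Xbar -> R[i] & forall p, circle_map (E p) /\
    forall x, E p (hembed x0 x) = cis ((p.2.+1`!)%:R^-1 * fa p.1 x)}.
  apply: (@choice _ _ (fun p (f : Xbar -> R[i]) => circle_map f /\
    forall x, f (hembed x0 x) = cis ((p.2.+1`!)%:R^-1 * fa p.1 x))) => -[a n] /=.
  have c : continuous (fun x => (n.+1`!)%:R^-1 * fa a x).
    by apply: continuous_mulr; [exact: cst_continuous|exact: cfa].
  have [f cf fP] := higson_extend_cis c (slow_scale (n.+1`!)%:R^-1 (sfa a)).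
  by exists f.
have ES a n p : E (a, n.+1) p ^+ n.+2 = E (a, n) p.
  have [[c1 _] e1] := EP (a, n); have [c2 e2] := EP (a, n.+1).
  have [c3 _] := circle_mapXn n.+2 c2.
  apply: (ccont_hembed_eq c3 c1) => x; rewrite e1 e2 /= -cisMn -[_ *+ _]mulr_natl.
  by congr cis; rewrite (factS n.+1) natrM invfM !mulrA mulfV ?mul1r// pnatr_eq0.
have ex p : exists t : G, forall a n, scoord t a n = E (a, n) p.
  apply: (@solenoid_ex R A (fun a n => E (a, n) p)) => a n; last exact: ES.
  by have [cE _] := EP (a, n); exact: circle_map_norm.
have FP p := svalP (cid (ex p)).
exists (fun p => sval (cid (ex p))).
  apply: continuous_solenoid => a n.
  rewrite (_ : (fun x => _) = E (a, n)); first by have [] := EP (a, n).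
  by apply/funext => p; rewrite FP.
by move=> a n x; rewrite FP; have [_ ->] := EP (a, n).
Qed.

Variable F : Xbar -> G.
Hypothesis cF : continuous F.
Hypothesis FE : forall a n x,
  scoord (F (hembed x0 x)) a n = cis ((n.+1`!)%:R^-1 * fa a x).

Lemma monomial_hembed (J : seq A) (n : nat) (k : A -> int) x :
  \prod_(a <- J) scoord (F (hembed x0 x)) a n ^ k a =
  cis ((n.+1`!)%:R^-1 * \sum_(a <- J) (k a)%:~R * fa a x).
Proof.
rewrite mulr_sumr cis_sum; apply: eq_bigr => a _.
by rewrite FE cisXz mulrCA.
Qed.

(* Of the three circle-valued maps [cis (fa (a i))], [i < 3], at least two agree
   with [cis g] at every point: a majority vote recovers [g]. *)
Lemma solenoid_extension_injective :
  (forall g : X -> R, higson_functions x0 g -> (forall x, 0 <= g x <= 1 / 2) ->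
    exists (a : nat -> A) (c : nat -> bool),
      forall i x, fa (a i) x = radial_bump x0 i c x + g x) ->
  injective F.
Proof.
move=> hg p q pq; apply: hcoord_ext => g.
have /higsonP [[M MP] cg gso] := set_valP g.
(* Scaling by c brings g into [-1/4, 1/4] and the shift by 1/4 into [0, 1/2]; the affine change
   separates the same points. *)
pose c : R := (4 * (`|M| + 1))^-1.
have M1 : 0 < `|M| + 1 by rewrite ltr_wpDl.
have c0 : 0 < c by rewrite invr_gt0 mulr_gt0.
pose g' x := c * set_val g x + 4^-1.
have cM : c * (`|M| + 1) = 4^-1 by rewrite /c invfM -mulrA mulVf ?mulr1// gt_eqF.
have g'b x : 0 <= g' x <= 1 / 2.
  have : `|c * set_val g x| <= 4^-1.
    rewrite normrM gtr0_norm// -cM ler_pM2l//; apply: le_trans (MP x) _.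
    by have := ler_norm M; lra.
  by rewrite ler_norml /g' => /andP[h1 h2]; apply/andP; split; lra.
have cg' : continuous g'.
  apply: continuous_addr; last exact: cst_continuous.
  by apply: continuous_mulr; [exact: cst_continuous|exact: cg].
have g'slow : slow g' x0.
  by apply: slow_add; [apply: slow_scale|apply: slow_cst].
have g'H : higson_functions x0 g'.
  apply/higsonP; split => //; exists 1 => x.
  by have /andP[h1 h2] := g'b x; rewrite ger0_norm//; lra.
pose G' := hcoord (SigSub (mem_set g'H) : higson_functions x0).
have G'E r : G' r = c * hcoord g r + 4^-1.
  have c1 : continuous (fun r => c * hcoord g r + 4^-1).
    apply: continuous_addr; last exact: cst_continuous.
    by apply: continuous_mulr; [exact: cst_continuous|exact: hcoord_continuous].
  apply: (hembed_eq (@hcoord_continuous _ _ _ _) c1) => x.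
  by rewrite !hcoordE.
have cG' : continuous G' by exact: hcoord_continuous.
have G'b r : `|G' r - 4^-1| <= 4^-1.
  apply: (@hembed_dense _ _ _ [set r | `|G' r - 4^-1| <= 4^-1]).
    apply: (@closed_comp _ _ (fun r => `|G' r - 4^-1|) [set t | t <= 4^-1]); last exact: closed_le.
    move=> r' _; apply: (@continuous_normr R _ (fun r => G' r - 4^-1)).
    by apply: continuous_subr => //; exact: cst_continuous.
  move=> x; change (`|g' x - 4^-1| <= 4^-1); have /andP[h1 h2] := g'b x.
  by rewrite ler_norml; apply/andP; split; lra.
have [a [code ac]] := hg g' g'H g'b.
pose u i r := scoord (F r) (a i) 0 / cis (G' r).
have cu i : circle_map (u i).
  apply: circle_map_div; last exact: circle_map_cis.
  exact: circle_map_comp cF (circle_map_scoord (a i) 0).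
have uE i x : u i (hembed x0 x) = cis (radial_bump x0 i code x).
  rewrite /u FE ac (_ : 1`! = 1%N)// invr1 mul1r cisD (_ : G' _ = g' x)// mulfK//.
  by rewrite norm1_neq0// cis_norm.
have two i j r : i != j -> u i r = 1 \/ u j r = 1.
  move=> ij.
  (* Disjointness of the bumps makes this product vanish on X, hence on the compactification by
     density. *)
  have : (1 - complex.Re (u i r)) * (1 - complex.Re (u j r)) = 0.
    have cr i' : continuous (fun r => 1 - complex.Re (u i' r)).
      by have [[cr _] _] := cu i'; apply: continuous_subr cr; exact: cst_continuous.
    apply: (hembed_eq (continuous_mulr (cr i) (cr j)) (@cst_continuous _ _ 0)) => x.
    rewrite !uE; have /eqP := bump_disjoint code (ln (1 + mdist x x0)) ij.
    by rewrite mulf_eq0 => /orP[] /eqP h; rewrite /radial_bump h cis0 subrr ?mul0r ?mulr0.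
  move/eqP; rewrite mulf_eq0 !subr_eq0 => /orP[] /eqP h; [left|right];
    apply: norm1_Re_ge1; rewrite -?h//; exact: circle_map_norm (cu _).
(* At most one of the three indices fails at p and at most one at q, so one index works at both. *)
have [i [ip iq]] : exists i, u i p = 1 /\ u i q = 1.
  have [h|h] := two 0%N 1%N p isT; have [h'|h'] := two 0%N 1%N q isT.
  - by exists 0%N.
  - have [|h2] := two 0%N 2%N q isT; first by exists 0%N.
    have [|h3] := two 1%N 2%N p isT; first by exists 1%N.
    by exists 2%N.
  - have [|h2] := two 0%N 2%N p isT; first by exists 0%N.
    have [|h3] := two 1%N 2%N q isT; first by exists 1%N.
    by exists 2%N.
  - by exists 1%N.
(* Both values lie in [0, 1/2], so equality modulo 1 is equality. *)
have GG : G' p = G' q.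
  apply/eqP; rewrite -subr_eq0; apply/eqP/cis_eq1_lt.
    have nz r : cis (G' r) != 0 by rewrite norm1_neq0// cis_norm.
    have hp : scoord (F p) (a i) 0 = cis (G' p).
      by rewrite -[LHS](divfK (nz p)) [_ / _]ip mul1r.
    have hq : scoord (F q) (a i) 0 = cis (G' q).
      by rewrite -[LHS](divfK (nz q)) [_ / _]iq mul1r.
    by rewrite cisB -hp -hq pq divff// hq.
  have := G'b p; have := G'b q; rewrite !ler_norml ltr_norml.
  by move=> /andP[? ?] /andP[? ?]; apply/andP; split; lra.
move: GG; rewrite !G'E => /addIr /mulfI; apply.
by rewrite gt_eqF.
Qed.

End solenoid_extension.

Lemma compact_hausdorff_embedding (S T : topologicalType) (f : S -> T) :
  compact [set: S] -> hausdorff_space T -> continuous f -> injective f ->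
  topological_embedding f.
Proof.
move=> cS hT cf fI; split => // U oU; exists (~` (f @` (~` U))).
  apply: closed_openC; apply: compact_closed => //.
  apply: continuous_compact; first exact: continuous_subspaceT.
  by apply: subclosed_compact cS (@subsetT _ _); exact: open_closedC.
rewrite eqEsubset; split => [_ [x Ux <-]|y [[x _ <-] nfx]].
  by split; [exists x|move=> [z nUz /fI zx]; apply: nUz; rewrite zx].
by exists x => //; apply: contrapT => nUx; apply: nfx; exists x.
Qed.

Lemma injective_surjective_bijective (S T : Type) (f : S -> T) :
  injective f -> (forall y, exists x, f x = y) -> bijective f.
Proof.
move=> fI fS; exists (fun y => sval (cid (fS y))) => [x|y].
  by apply: fI; exact: svalP (cid (fS (f x))).
exact: svalP (cid (fS y)).
Qed.

(* Not imported earlier because it shadows the real number [pi]. *)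
From mathcomp Require Import generic_quotient.

(** * The induced map on first cohomology *)

Section main_cohomology.
Context {R : realType} {X : metricType R} (x0 : X) (B : set (X -> R)).
Hypotheses (Xgeo : geodesic_metric X) (Xsc : simply_connected R X).
Hypotheses (BL : B `<=` slow_continuous x0) (Bi : independent B).
Hypothesis Bspan : forall f, slow_continuous x0 f -> exists (d : nat) s k,
  [/\ uniq s, forall g, g \in s -> B g &
    bounded_fct (fun x => d.+1%:R * f x - combination k s x)].
Local Notation Xbar := (higson_compactification x0).
Local Notation G := (@solenoid_power R B).

Variable F : continuousType Xbar G.
Hypothesis FE : forall (a : B) n x,
  scoord (F (hembed x0 x)) a n = cis ((n.+1`!)%:R^-1 * set_val a x).

Lemma metric_int_cst (g : X -> R) : continuous g -> (forall x, cis (g x) = 1) ->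
  forall x y, g x = g y.
Proof.
move=> cg g1 x y; have [c [cc c0 c1 _]] := geodesic_path Xgeo x y.
have cgc : continuous (fun t => g (c t)) by exact: continuous_composition cc cg.
have i0 : `[0, 1]%classic (0 : R) by rewrite /= in_itv /= lexx ler01.
have i1 : `[0, 1]%classic (1 : R) by rewrite /= in_itv /= lexx ler01.
rewrite -c0 -c1.
exact: (connected_int_cst (@segment_connected R 0 1) cgc (fun t _ => g1 _) i0 i1).
Qed.

(** The quotient of two representatives is a monomial in the coordinates times an exponential. If it
    has a logarithm after pulling back, the corresponding combination of members of [B] is bounded,
    so all exponents vanish by independence and the logarithm already exists on the power of the
    solenoid. *)
Lemma cechH1_map_injective : injective (cechH1_map F).
Proof.
move=> y z; rewrite -(reprK y) -(reprK z); set a := repr y; set b := repr z.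
rewrite !cechH1_mapE => /cech_piP ab; apply/cech_piP.
have [fa cfa ra] := cocycle_represents (R := R) a compact_solenoid_power hausdorff_solenoid_power.
have [fb cfb rb] := cocycle_represents (R := R) b compact_solenoid_power hausdorff_solenoid_power.
have [r cr rE] := represents_equiv (represents_map F ra) (represents_map F rb) ab.
have cq := circle_map_div cfa cfb.
have [n [J [k [q [uJ cq' qE]]]]] := solenoid_circle_map cq.
have nb t : fb t != 0 by rewrite norm1_neq0// circle_map_norm.
pose comb x : R := \sum_(i <- J) (k i)%:~R * set_val i x.
pose c : R := (n.+1`!)%:R^-1.
(* Over X, both [r] and [c * comb + q] composed with [F] are logarithms of the same quotient; their
   difference is integer-valued, so constant. As [q] and [r] are bounded on the compactification,
   [comb] is bounded. *)
pose m x : R := c * comb x + q (F (hembed x0 x)) - r (hembed x0 x).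
have cF : continuous F by exact: cts_fun.
have cqF : continuous (fun p => q (F p)) by exact: continuous_composition cF cq'.
have ccomb : continuous comb.
  apply: continuous_sumr => i; apply: continuous_mulr; first exact: cst_continuous.
  by have [] := BL (set_valP i).
have ch := @hembed_continuous R X x0.
have cm : continuous m.
  apply: continuous_subr; last exact: continuous_composition ch cr.
  apply: continuous_addr; last exact: continuous_composition ch cqF.
  by apply: continuous_mulr ccomb; exact: cst_continuous.
have m1 x : cis (m x) = 1.
  rewrite /m cisB cisD -(monomial_hembed FE) -qE.
  have := rE (hembed x0 x) => /= ->; rewrite mulrAC mulfK ?mulfV//.
  by rewrite norm1_neq0// cis_norm.
have comb_bounded : bounded_fct comb.
  have [M MP] := higson_bounded cr; have [N NP] := higson_bounded cqF.
  have c0 : c != 0 by rewrite invr_eq0 pnatr_eq0 -lt0n fact_gt0.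
  exists (`|c^-1| * (`|m x0| + M + N)) => x.
  have -> : comb x = c^-1 * (m x0 + r (hembed x0 x) - q (F (hembed x0 x))).
    by rewrite (metric_int_cst cm m1 x0 x) /m; field.
  rewrite normrM ler_wpM2l//; apply: le_trans (ler_normB _ _) _.
  by apply: lerD => //; apply: le_trans (ler_normD _ _) _; rewrite lerD2l.
pose K (f : X -> R) : int := if insub f is Some i then k i else 0.
have KE (i : B) : K (set_val i) = k i by rewrite /K valK.
have k0 (i : B) : i \in J -> k i = 0.
  move=> iJ; rewrite -KE.
  apply: (Bi (s := [seq set_val j | j <- J])).
  - by rewrite map_inj_uniq//; exact: val_inj.
  - by move=> f /mapP [j _ ->]; exact: set_valP.
  - have [M MP] := comb_bounded; exists M => x; rewrite /combination big_map.
    by under eq_bigr do rewrite KE; exact: MP.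
  - exact: map_f.
apply: (equiv_represents ra rb cq') => t.
have := qE t; rewrite big_seq big1 => [|i iJ]; last by rewrite k0// expr0z.
by rewrite mul1r => <-; rewrite mulrC divfK.
Qed.

(** On X the representative has a slowly oscillating logarithm h, and [Bspan] writes h as a rational
    combination of [B] plus a bounded function. The former comes from a monomial on the power of the
    solenoid, the latter extends to the compactification and does not change the class. *)
Lemma cechH1_map_surjective y : exists z, cechH1_map F z = y.
Proof.
rewrite -(reprK y); set a := repr y.
have [f cf ra] := cocycle_represents (R := R) a (@compact_higson R X x0)
  (@hausdorff_higson R X x0).
have ch := @hembed_continuous R X x0.
have [h chh hE] := circle_map_log Xgeo Xsc (circle_map_comp ch cf).
have hso : slow h x0 by exact: higson_circle_slow cf chh hE.
have [d [s [k [us sB bk]]]] := Bspan (conj chh hso).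
have [J Js] : exists J : seq B, [seq set_val j | j <- J] = s.
  elim: s {us bk} sB => [|g s ih] sB; first by exists [::].
  have [J Js] := ih (fun f fs => sB f (mem_behead (s := g :: s) fs)).
  by exists (SigSub (mem_set (sB g (mem_head _ _))) :: J); rewrite /= Js.
have csB : forall g, g \in s -> slow_continuous x0 g by move=> g /sB /BL.
pose comb := combination k s.
have [ccomb socomb] : slow_continuous x0 comb.
  rewrite /comb /combination -Js; split.
    under eq_fun do rewrite big_map.
    apply: continuous_sumr => i; apply: continuous_mulr; first exact: cst_continuous.
    by have [] := BL (set_valP i).
  under eq_fun do rewrite big_map.
  by apply: slow_sum => i; apply: slow_scale; have [_] := BL (set_valP i).
pose c : R := d.+1%:R^-1.
have d0 : d.+1%:R != 0 :> R by rewrite pnatr_eq0.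
pose w x := c * (d.+1%:R * h x - comb x).
have wso : slow w x0.
  apply: slow_scale; apply: slow_add; first exact: slow_scale.
  by under eq_fun do rewrite -mulN1r; exact: slow_scale.
have cw : continuous w.
  apply: continuous_mulr; first exact: cst_continuous.
  by apply: continuous_subr ccomb; apply: continuous_mulr => //; exact: cst_continuous.
have [r cr rE] := higson_extend_real (bounded_fctZ c bk) cw wso.
(* At level d the coordinates are logarithms over (d+1)!, so the exponent factor d! produces the
   denominator d+1 of [Bspan]. *)
pose chi (t : G) := \prod_(j <- J) scoord t j d ^ (k (set_val j) * d`!%:Z).
have cchi : circle_map chi.
  by apply: circle_map_prod => j; apply: circle_mapXz; exact: circle_map_scoord.
have [b rb] := represents_ex cchi.
exists (\pi_(cechH1 G) b)%qT; rewrite cechH1_mapE; apply/cech_piP/cech_equiv_sym.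
have cF : continuous F by exact: cts_fun.
have cchiF : circle_map (chi \o F) by exact: circle_map_comp cF cchi.
apply: (equiv_represents ra (represents_map F rb) cr).
have [c1 _] := cf; have [c2 _] := circle_mapM cchiF (circle_map_cis cr).
apply: (ccont_hembed_eq c1 c2) => x.
rewrite hE rE /= /chi (monomial_hembed FE) -cisD; congr cis.
rewrite /w /comb /combination -Js big_map factS natrM invfM.
have -> : \sum_(j <- J) (k (set_val j) * d`!)%:~R * set_val j x
    = (d`!)%:R * \sum_(j <- J) (k (set_val j))%:~R * set_val j x.
  rewrite mulr_sumr; apply: eq_bigr => j _; rewrite intrM -pmulrn mulrAC.
  by rewrite mulrC.
have f0 : (d`!)%:R != 0 :> R by rewrite pnatr_eq0 -lt0n fact_gt0.
rewrite -/c; set S := \sum_(j <- J) _; move: f0.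
have := d0; rewrite /c; move: (d`!%:R : R) (d.+1%:R : R) => u v v0 u0.
by field; rewrite u0 v0.
Qed.

End main_cohomology.

Unset Implicit Arguments.
Unset Printing Implicit Defensive.

(* Noncompactness is implicit in the limit d(x, x0) -> oo.  If X is compact, its
   Higson compactification is X itself, and the conclusion fails already for
   X = [0, 1]: then H^1(X) = 0, whereas H^1 of a product of copies of the
   solenoid vanishes only for the empty product, which is a point. *)
Theorem theorem3p1 (R : realType) (X : metricType R) (x0 : X)
    (Xsc : simply_connected R X) (Xproper : proper_metric X)
    (Xgeodesic : geodesic_metric X) (Xnoncompact : ~ compact [set: X]) :
  exists (A : Type)
         (F : continuousType (higson_compactification x0)
                (prod_topology (fun _ : A => adelic_solenoid R))),
    topological_embedding F /\
    bijective (cechH1_map F : {additive _ -> _}).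
Proof.
have [e eI] := continuous_code x0 Xproper.
have [B [B0B BL Bi Bspan]] := maximal_independent (@coded_family_slow R X x0 e)
  (@coded_family_independent R X x0 Xproper Xgeodesic Xnoncompact e eI).
have cB (a : B) : continuous (set_val a) by have [] := BL _ (set_valP a).
have sB (a : B) : slow (set_val a) x0 by have [] := BL _ (set_valP a).
have [F cF FE] := solenoid_extension cB sB.
have FI : injective F.
  apply: (solenoid_extension_injective cF FE) => g gH g01.
  have iB i : B (coded x0 e g i) by apply: B0B; exists g, i.
  by exists (fun i => SigSub (mem_set (iB i))), (e g).
pose F' : continuousType (higson_compactification x0) (@solenoid_power R B) :=
  HB.pack F (isContinuous.Build _ _ F cF).
exists B, F'; split.
  exact: compact_hausdorff_embedding (@compact_higson R X x0)
    hausdorff_solenoid_power cF FI.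
apply: injective_surjective_bijective.
  exact: (@cechH1_map_injective R X x0 B Xgeodesic BL Bi F' FE).
exact: (@cechH1_map_surjective R X x0 B Xgeodesic Xsc BL Bspan F' FE).
Qed.
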